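(* Let $F\subset\mathbb{R}^3$ be any sphere (of positive radius) and let $O\in\mathbb{R}^3$ be any point. Then $F$ admits a rational polar representation with respect to the focus point $O$: taking $O$ as the origin, there are rational functions $\rho\in\mathbb{R}(u,v)$ and $\mathbf{k}=(k_1,k_2,k_3)\in\mathbb{R}(u,v)^3$, where $\mathbf{k}$ is a (not necessarily proper) rational parameterization of the unit sphere $S^2$, such that $\mathbf{f}(u,v)=\rho(u,v)\,\mathbf{k}(u,v)$ is a rational parameterization of $F$. Consequently, the conchoid surfaces of $F$ with respect to $O$ admit rational parameterizations: for every distance $d>0$, the conchoid surface of $F$ with respect to $O$ at distance $d$ is the Zariski closure of the union of the images of the rational maps $(\rho(u,v)+d)\,\mathbf{k}(u,v)$ and $(\rho(u,v)-d)\,\mathbf{k}(u,v)$.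
   Context: Everything is over $\mathbb{R}$. A rational parameterization of a surface is a tuple of rational functions in $\mathbb{R}(u,v)$ whose image is two-dimensional and Zariski dense in the surface; it need not be proper (generically injective). $S^2=\{x\in\mathbb{R}^3:\|x\|=1\}$. If $\mathbf{f}=\rho\mathbf{k}$ with $\|\mathbf{k}\|=1$ identically, then $\rho^2=\|\mathbf{f}\|^2$; $\rho$ is called the (rational) radius function and describes the distance from $O$ up to sign. The conchoid surface of a surface $F\subset\mathbb{R}^3$ with respect to the focus point $O$ at distance $d>0$ is the Zariski closure of the set of all points $Q$ for which there is a point $P\in F$, $P\neq O$, such that $Q$ lies on the line $OP$ and $\|Q-P\|=d$. (If $F$ is centered at $O$ and $d$ equals its radius, one of the two maps $(\rho\pm d)\mathbf{k}$ is constant, and one part of the conchoid degenerates to the point $O$.) *)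

(* Defs.v *)
From mathcomp Require Export all_boot all_order all_algebra.
From mathcomp Require Export boolp classical_sets reals.
From mathcomp Require Export fraction mpoly.

Set Implicit Arguments.
Unset Strict Implicit.
Unset Printing Implicit Defensive.

Import Order.TTheory GRing.Theory Num.Theory.

Local Open Scope classical_set_scope.
Local Open Scope ring_scope.

(* Points of R^n are row vectors; for [x : 'rV[R]_n], [x 0 : 'I_n -> R] is the
   valuation at which polynomials are evaluated. *)

(* Euclidean norm; the library norm on row vectors is the sup norm. *)
Definition enorm (R : realType) (n : nat) (x : 'rV[R]_n) : R :=
  Num.sqrt (\sum_(i < n) x 0 i ^+ 2).

Definition sphere (R : realType) (c : 'rV[R]_3) (r : R) : set 'rV[R]_3 :=
  [set x | enorm (x - c) = r].

Definition zclosed (R : realType) (n : nat) (Z : set 'rV[R]_n) : Prop :=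
  exists I : set {mpoly R[n]}, Z = [set x | forall p, I p -> p.@[x 0] = 0].

Definition zclosure (R : realType) (n : nat) (S : set 'rV[R]_n) :
    set 'rV[R]_n :=
  [set x | forall Z, zclosed Z -> S `<=` Z -> Z x].

Definition zirreducible (R : realType) (n : nat) (Z : set 'rV[R]_n) : Prop :=
  Z !=set0 /\
  forall A B : set 'rV[R]_n, zclosed A -> zclosed B ->
    Z `<=` A `|` B -> Z `<=` A \/ Z `<=` B.

(* Z 0 < ... < Z m : a strict chain of m + 1 irreducible closed subsets. *)
Definition zchain (R : realType) (n : nat) (X : set 'rV[R]_n) (m : nat)
    (Z : nat -> set 'rV[R]_n) : Prop :=
  (forall i, (i <= m)%N -> [/\ zclosed (Z i), zirreducible (Z i) & Z i `<=` X])
  /\ (forall i, (i < m)%N -> Z i `<` Z i.+1).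

(* The dimension of S is the Krull dimension of its Zariski closure. Chains can
   be truncated, so excluding length m + 1 excludes all greater lengths. *)
Definition zdim (R : realType) (n : nat) (S : set 'rV[R]_n) (m : nat) : Prop :=
  (exists Z, zchain (zclosure S) m Z) /\
  ~ (exists Z, zchain (zclosure S) m.+1 Z).

(* The field R(u,v). *)
Definition ratfun (R : realType) := {fraction {mpoly R[2]}}.

Definition ratC (R : realType) (a : R) : ratfun R := tofrac (a%:MP_[2]).

(* [g] is defined at [a], with value [y]: some representation of [g] as a
   quotient of polynomials has a denominator that does not vanish at [a]. The
   value does not depend on the representation. *)
Definition ratval (R : realType) (g : ratfun R) (a : 'rV[R]_2) (y : R) : Prop :=
  exists p q : {mpoly R[2]},
    [/\ q.@[a 0] != 0, g = tofrac p / tofrac q & y = p.@[a 0] / q.@[a 0]].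

(* Image of the partial map R^2 -> R^3 given by a triple of rational functions,
   over the points where all three are defined. *)
Definition ratimage (R : realType) (f : 'rV[ratfun R]_3) : set 'rV[R]_3 :=
  [set x | exists a : 'rV[R]_2, forall i, ratval (f 0 i) a (x 0 i)].

(* [f] need not be generically injective. *)
Definition rational_param (R : realType) (f : 'rV[ratfun R]_3)
    (X : set 'rV[R]_3) : Prop :=
  [/\ ratimage f `<=` X, X `<=` zclosure (ratimage f) & zdim (ratimage f) 2].

(* The map O + rho k, i.e. rho k read in coordinates with origin O. *)
Definition polar_map (R : realType) (O : 'rV[R]_3) (rho : ratfun R)
    (k : 'rV[ratfun R]_3) : 'rV[ratfun R]_3 :=
  map_mx (@ratC R) O + rho *: k.

Definition polar_representation (R : realType) (O : 'rV[R]_3)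
    (F : set 'rV[R]_3) (rho : ratfun R) (k : 'rV[ratfun R]_3) : Prop :=
  rational_param k (sphere 0 1) /\ rational_param (polar_map O rho k) F.

Definition conchoid (R : realType) (F : set 'rV[R]_3) (O : 'rV[R]_3) (d : R) :
    set 'rV[R]_3 :=
  zclosure [set Q | exists P, [/\ F P, P <> O,
    exists t : R, Q = O + t *: (P - O) & enorm (Q - P) = d]].

(* Main.v *)
Require Import Defs.
From HB Require Import structures.
From mathcomp Require Import ring lra zify.
Import Order.TTheory GRing.Theory Num.Theory.
Set Implicit Arguments.
Unset Strict Implicit.
Unset Printing Implicit Defensive.
Local Open Scope classical_set_scope.
Local Open Scope ring_scope.

(** The representation is found by looking for points [f] of the sphere, with the
    focus [O] as origin, whose distance [rho] from [O] is a rational function of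
    the parameters; then [k = f / rho]. Let [m] be the distance of the centre
    from [O]. If [m = 0], the distance is constant and every rational
    parametrization will do. Otherwise turn the centre to the third axis. The
    distance determines the third coordinate of [f], and the other two have a
    sum of squares which is a quartic polynomial in [rho], nonnegative on the
    interval between [|m - r|] and [m + r]. Substituting for [rho] a convex
    combination of the end points with weights [cos^2] and [sin^2] makes this
    quartic an explicit sum of two squares of rational functions, and a
    rotation about the axis adds the second parameter ([point_fun],
    [point_fun_norm]). Since the rational functions [cosr] and [sinr] reach all
    points of the circle, [rho] and [f] are defined everywhere and [f] reaches
    every point of the sphere ([point_fun_surj]).

    This surjectivity makes the conchoids easy: a point [Q] on the line from [O]
    to [P = O + rho k] at distance [d] from [P] is [O + (rho + d) k] or
    [O + (rho - d) k]. Conversely such a point comes from a [P] of the sphere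
    unless the parameters are special, and [ratimage_generic] shows that special
    parameters only add limit points.

    Two facts about Zariski closures remain. The image of [k] is dense in the
    unit sphere, although it is only a cone of directions if [O] is outside of
    the sphere ([radial_zdense]); and the dimension of a sphere is two
    ([zdim_sphere]). For density and for irreducibility, polynomials are
    restricted to rational curves, where they become polynomials in one
    variable: two points of a sphere always lie on a great circle. For the
    upper bound on the dimension, a chain of irreducible closed sets in
    [n]-space of length [n.+1] is excluded ([krull_dim_affine_space]): it would
    contain [n.+1] algebraically independent polynomials in [n] variables. *)

(** * Zariski closed sets *)

Section ZariskiBasics.
Variables (R : realType) (n : nat).
Implicit Types (S Z : set 'rV[R]_n) (x y : 'rV[R]_n) (p q : {mpoly R[n]}).

Lemma zclosed_mpoly p : zclosed [set x | p.@[x 0] = 0].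
Proof.
exists [set p]; apply/seteqP; split=> y /=; first by move=> ? ? ->.
by apply.
Qed.

Lemma zclosed_zclosure S : zclosed (zclosure S).
Proof.
exists [set p | forall x, S x -> p.@[x 0] = 0].
apply/seteqP; split => x /=.
  by move=> xS p pS; apply: (xS [set y | p.@[y 0] = 0]) => //; exact: zclosed_mpoly.
move=> xS Z [I ->] SI q Iq; apply: xS => y Sy; exact: (SI _ Sy).
Qed.

Lemma sub_zclosure S : S `<=` zclosure S.
Proof. by move=> x Sx Z _; apply. Qed.

Lemma zclosure_min S Z : zclosed Z -> S `<=` Z -> zclosure S `<=` Z.
Proof. by move=> Zc SZ x; apply. Qed.

Lemma zclosureS S S' : S `<=` S' -> zclosure S `<=` zclosure S'.
Proof.
by move=> SS'; apply: zclosure_min (zclosed_zclosure _) _ => x /SS'/sub_zclosure.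
Qed.

Lemma in_zclosure S x :
  (forall p, (forall y, S y -> p.@[y 0] = 0) -> p.@[x 0] = 0) -> zclosure S x.
Proof. by move=> h Z [I ->] SI p Ip; apply: h => y /SI /(_ _ Ip). Qed.

Lemma zclosed_nmem Z x :
  zclosed Z -> ~ Z x -> exists2 p, forall y, Z y -> p.@[y 0] = 0 & p.@[x 0] != 0.
Proof.
move=> [I ->] /= /existsNP[p /not_implyP[Ip /eqP px]].
by exists p => // y; apply.
Qed.

Lemma zclosedI Z Z' : zclosed Z -> zclosed Z' -> zclosed (Z `&` Z').
Proof.
move=> [I ->] [J ->]; exists (I `|` J); apply/seteqP; split=> x /=.
  by move=> [xI xJ] p [/xI|/xJ].
by move=> xIJ; split=> p ?; apply: xIJ; [left|right].
Qed.

(** The ideal of an irreducible set is prime. *)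
Lemma zirreducible_mul Z p q : zirreducible Z ->
  (forall x, Z x -> (p * q).@[x 0] = 0) ->
  (forall x, Z x -> p.@[x 0] = 0) \/ (forall x, Z x -> q.@[x 0] = 0).
Proof.
move=> [_ Zirr] pq0.
apply: (Zirr _ _ (zclosed_mpoly p) (zclosed_mpoly q)) => x /pq0 /= /eqP.
by rewrite mevalM mulf_eq0 => /orP[]/eqP; [left|right].
Qed.

End ZariskiBasics.

(** * Rational curves, density and irreducibility *)

Section RationalCurves.
Variables (R : realType) (n : nat).
Implicit Types (num : 'I_n -> {poly R}) (den : {poly R}) (p : {mpoly R[n]}).

Definition curve num den (t : R) : 'rV[R]_n :=
  \row_i ((num i).[t] / den.[t]).

(** Clearing denominators: every monomial of [p] has degree below [msize p], so
    this power of the common denominator makes [p] polynomial on the curve. *)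
Lemma restrict_to_curve p num den : exists h : {poly R}, forall t, den.[t] != 0 ->
  h.[t] = den.[t] ^+ msize p * p.@[curve num den t 0].
Proof.
exists (\sum_(m <- msupp p) (p@_m)%:P *
         ((\prod_i num i ^+ m i) * den ^+ (msize p - mdeg m))) => t dt.
rewrite horner_sum mevalE big_distrr /=; apply: eq_big_seq => m mp.
rewrite hornerM hornerC mulrCA; congr (_ * _).
rewrite hornerM horner_prod horner_exp.
have mdeglt : (mdeg m <= msize p)%N by exact: ltnW (msize_mdeg_lt mp).
under [in RHS]eq_bigr do rewrite mxE expr_div_n.
rewrite big_split /= prodfV mulrCA; congr (_ * _).
  by apply: eq_bigr => i _; rewrite horner_exp.
rewrite prodrXr -mdegE -(subnK mdeglt) exprD addnK mulfK //.
by rewrite expf_neq0.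
Qed.

(** Over a field this says that [A] is infinite; it is the form in which
    infinitely many parameters are used, since a polynomial function that
    vanishes on a closed set is tested along a curve. *)
Definition poly_determining (A : set R) :=
  forall h : {poly R}, (forall t, A t -> h.[t] = 0) -> h = 0.

Lemma poly_determining_interval (e : R) : 0 < e ->
  poly_determining [set t | 0 < t < e].
Proof.
move=> e0 h h0; apply/eqP/negPn/negP => hN0.
(* more roots of [h] in the interval than its degree allows *)
pose s := [seq e / (i.+2)%:R | i <- iota 0 (size h)].
have : (size s < size h)%N.
  apply: max_poly_roots => //.
    apply/allP => _ /mapP[i _ ->]; apply/eqP/h0 => /=.
    rewrite divr_gt0 ?ltr0n //= ltr_pdivrMr ?ltr0n // ltr_pMr //.
    by rewrite ltr1n.
  rewrite map_inj_uniq ?iota_uniq // => i j /(mulfI (lt0r_neq0 e0)).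
  by move=> /invr_inj/eqP; rewrite eqr_nat => /eqP [].
by rewrite size_map size_iota ltnn.
Qed.

Lemma poly_determining_cofinite (e : {poly R}) : e != 0 ->
  poly_determining [set t | e.[t] != 0].
Proof.
move=> e0 h h0; have /eqP : h * e = 0.
  apply: (poly_determining_interval ltr01) => t _; rewrite hornerM.
  by have [->|/h0 ->] := eqVneq e.[t] 0; rewrite ?mulr0 ?mul0r.
by rewrite mulf_eq0 (negPf e0) orbF => /eqP.
Qed.

(** A polynomial that vanishes on infinitely many points of a rational curve
    vanishes on the whole curve. *)
Lemma curve_zclosure (S : set 'rV[R]_n) num den (A : set R) t0 :
  poly_determining A -> den.[t0] != 0 ->
  (forall t, A t -> den.[t] != 0 -> S (curve num den t)) ->
  zclosure S (curve num den t0).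
Proof.
move=> detA dt0 AS; apply: in_zclosure => p pS.
have [h hE] := restrict_to_curve p num den.
(* the factor [den] takes care of the parameters of [A] where the curve is
   undefined *)
have /eqP : h * den = 0.
  apply: detA => t At; rewrite hornerM.
  have [->|dt] := eqVneq den.[t] 0; first by rewrite mulr0.
  by rewrite hE // pS ?mulr0 ?mul0r //; exact: AS.
rewrite mulf_eq0 => /orP[]/eqP d0; last by move: dt0; rewrite d0 horner0 eqxx.
have := hE _ dt0; rewrite d0 horner0 => /esym/eqP.
by rewrite mulf_eq0 expf_eq0 (negPf dt0) andbF /= => /eqP.
Qed.

Definition joined_by_curve (Z : set 'rV[R]_n) (x y : 'rV[R]_n) :=
  exists num den, [/\ forall t, den.[t] != 0, forall t, Z (curve num den t),
    exists t, curve num den t = x & exists t, curve num den t = y].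

(** If [Z] is covered by closed sets [A] and [B], of which the first misses a
    point [x] and the second a point [y] of [Z], then a polynomial vanishing on
    [A] and one vanishing on [B] restrict to nonzero polynomials on a curve
    through [x] and [y], although their product vanishes there. This avoids any
    computation with ideals of the sphere or of its circles. *)
Lemma zirreducible_curves (Z : set 'rV[R]_n) :
  Z !=set0 -> (forall x y, Z x -> Z y -> joined_by_curve Z x y) ->
  zirreducible Z.
Proof.
move=> Z0 Zj; split=> // A B Ac Bc ZAB; apply: contrapT => /not_orP.
move=> [/existsNP[x /not_implyP[Zx Ax]] /existsNP[y /not_implyP[Zy By]]].
have [p pA px] := zclosed_nmem Ac Ax; have [q qB qy] := zclosed_nmem Bc By.
have [num [den [den0 Zc [tx cx] [ty cy]]]] := Zj _ _ Zx Zy.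
have [h hE] := restrict_to_curve p num den.
have [g gE] := restrict_to_curve q num den.
have /eqP : h * g = 0.
  apply: (poly_determining_interval ltr01) => t _; rewrite hornerM hE ?gE //.
  by have [/pA->|/qB->] := ZAB _ (Zc t); rewrite ?(mulr0, mul0r).
rewrite mulf_eq0 => /orP[]/eqP E.
  move: (hE tx (den0 _)); rewrite E horner0 cx => /esym/eqP.
  by rewrite mulf_eq0 expf_eq0 (negPf (den0 _)) andbF (negPf px).
move: (gE ty (den0 _)); rewrite E horner0 cy => /esym/eqP.
by rewrite mulf_eq0 expf_eq0 (negPf (den0 _)) andbF (negPf qy).
Qed.

Lemma zirreducible_setT : zirreducible [set: 'rV[R]_n].
Proof.
apply: zirreducible_curves => [|x y _ _]; first by exists 0.
exists (fun i => (x 0 i)%:P + (y 0 i - x 0 i) *: 'X), 1.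
split=> //; first by move=> t; rewrite hornerC oner_eq0.
  by exists 0; apply/rowP=> i; rewrite mxE !hornerE /= divr1 ?mulr0 ?addr0.
by exists 1; apply/rowP=> i; rewrite mxE !hornerE /= divr1; ring.
Qed.

End RationalCurves.

(** * The dimension of affine space is at most its number of coordinates *)

Section Monomials.
Variables (R : realType) (n N : nat) (x : nat -> {mpoly R[n]}).

(** Vectors of [k] exponents below [N], as nested pairs: this makes the last
    exponent, on which the induction below acts, directly accessible to sums. *)
Fixpoint exponent (k : nat) : finType :=
  if k is k'.+1 then (exponent k' * 'I_N)%type else unit.

Fixpoint monomial (k : nat) : exponent k -> {mpoly R[n]} :=
  if k is k'.+1 then fun t : exponent k'.+1 => monomial t.1 * x k' ^+ t.2
  else fun=> 1.

Lemma card_exponent k : #|exponent k| = (N ^ k)%N.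
Proof.
by elim: k => [|k IH]; rewrite ?card_unit //= card_prod IH card_ord expnSr.
Qed.

Lemma msize_monomial d k (t : exponent k) : (forall i, (msize (x i) <= d.+1)%N) ->
  (msize (monomial t) <= (k * (d * N)).+1)%N.
Proof.
move=> xd; have msz (p q : {mpoly R[n]}) a b : (msize p <= a.+1)%N ->
    (msize q <= b.+1)%N -> (msize (p * q) <= (a + b).+1)%N.
  move=> pa qb; have [->|p0] := eqVneq p 0; first by rewrite mul0r msize0.
  have [->|q0] := eqVneq q 0; first by rewrite mulr0 msize0.
  rewrite msizeM // -subn1 leq_subLR; apply: leq_trans (leq_add pa qb) _; lia.
have mexp (p : {mpoly R[n]}) e a : (msize p <= a.+1)%N ->
    (msize (p ^+ e) <= (a * e).+1)%N.
  move=> pa; elim: e => [|e IH]; first by rewrite expr0 msize1.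
  by rewrite exprS mulnS; apply: msz.
elim: k t => [|k IH] t /=; first by rewrite msize1.
have -> : (k.+1 * (d * N))%N = (k * (d * N) + d * N)%N by lia.
apply: msz; first exact: IH.
apply: leq_trans (mexp _ _ _ (xd k)) _.
by rewrite ltnS leq_mul2l (ltnW (ltn_ord t.2)) orbT.
Qed.

(** In a strict chain of irreducible closed sets, let [x i] vanish on [Z i] but
    not on [Z i.+1]. Then no nontrivial polynomial relation between the [x i],
    [i < k], holds on [Z k]. Indeed, factor the lowest power of the last element
    [x k] out of a relation on [Z k.+1]; as [x k] is nonzero there and the ideal
    is prime, the other factor vanishes on [Z k.+1], hence on [Z k], where
    [x k] is zero: this leaves a nontrivial relation between the [x i],
    [i < k], on [Z k]. *)
Lemma monomials_free (Z : nat -> set 'rV[R]_n) k (c : exponent k -> R) :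
  (forall i, (i <= k)%N -> zirreducible (Z i)) ->
  (forall i, (i < k)%N -> [/\ Z i `<=` Z i.+1,
     forall y, Z i y -> (x i).@[y 0] = 0 &
     ~ forall y, Z i.+1 y -> (x i).@[y 0] = 0]) ->
  (exists t, c t != 0) ->
  ~ forall y, Z k y -> (\sum_t c t *: monomial t).@[y 0] = 0.
Proof.
elim: k c => [|k IH] c Zirr Zx [t0 ct0].
  have [[y Zy] _] := Zirr 0%N (leqnn _) => /(_ y Zy) /eqP.
  rewrite (bigD1 t0) //= big1 ?addr0; last by case=> /=; case: (t0).
  by rewrite mevalZ meval1 mulr1 (negPf ct0).
have [ZS xZ xnZ] := Zx k (leqnn _).
pose P (e : 'I_N) := [exists t, c (t, e) != 0].
have Pt0 : P t0.2 by apply/existsP; exists t0.1; case: (t0) ct0.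
(* [e] is the lowest exponent of [x k] in the relation, and [x k ^+ e * G] the
   resulting factorization *)
case: (arg_minnP (fun e : 'I_N => e : nat) Pt0) => e /existsP Pe emin.
pose A e' := \sum_t c (t, e') *: monomial t.
pose G := \sum_(e' < N | (e <= e')%N) A e' * x k ^+ (e' - e).
have -> : \sum_t c t *: monomial t = x k ^+ e * G.
  transitivity (\sum_(e' < N) A e' * x k ^+ e').
    rewrite /A; under [in RHS]eq_bigr do rewrite big_distrl /=.
    rewrite exchange_big pair_big /=; apply: eq_bigr => -[t e'] _ /=.
    by rewrite scalerAl.
  rewrite (bigID (fun e' : 'I_N => (e <= e')%N)) /= [X in _ + X]big1 => [|e'].
    rewrite addr0 big_distrr /=; apply: eq_bigr => e' ee'.
    by rewrite mulrCA -exprD subnKC.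
  rewrite -ltnNge => e'e; rewrite /A big1 ?mul0r // => t _.
  have [->|cN0] := eqVneq (c (t, e')) 0; first by rewrite scale0r.
  have := emin e'; rewrite leqNgt e'e.
  by move=> /(_ (introT existsP (ex_intro _ t cN0))).
have Zk1 := Zirr k.+1 (leqnn _).
move=> /(zirreducible_mul Zk1)[].
  elim: (e : nat) => [|j IHj].
    by case: Zk1 => -[y Zy] _ /(_ y Zy)/eqP; rewrite expr0 meval1 oner_eq0.
  by rewrite exprS => /(zirreducible_mul Zk1)[].
move=> G0; apply: (IH (fun t => c (t, e))) => //.
- by move=> i ik; apply: Zirr; apply: leqW.
- by move=> i ik; apply: Zx; apply: leqW.
move=> y Zy; have := G0 _ (ZS _ Zy).
rewrite /G (bigD1 e) //= subnn expr0 mulr1 mevalD.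
rewrite [X in _ + X](big_morph (meval (y 0)) (mevalD _) (meval0 _)).
rewrite [X in _ + X]big1 ?addr0; first exact.
move=> e' /andP[ee' e'e].
rewrite mevalM rmorphXn /= xZ // expr0n subn_eq0 leqNgt.
by rewrite ltn_neqAle ee' andbT eq_sym (inj_eq val_inj) e'e mulr0.
Qed.

End Monomials.

(** More vectors than coordinates. *)
Lemma nontrivial_relation (R : fieldType) (T J : finType) (M : T -> J -> R) :
  (#|J| < #|T|)%N ->
  exists2 c : T -> R, exists t, c t != 0 & forall j, \sum_t c t * M t j = 0.
Proof.
move=> JT; pose A := \matrix_(i < #|T|, j < #|J|) M (enum_val i) (enum_val j).
have : kermx A != 0.
  rewrite kermx_eq0 /row_free neq_ltn (leq_ltn_trans _ JT) //.
  exact: rank_leq_col.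
move=> /rowV0Pn[v /sub_kermxP vA v0].
exists (fun t => v 0 (enum_rank t)).
  have /rV0Pn[i vi] := v0.
  by exists (enum_val i); rewrite enum_valK.
move=> j; have /rowP/(_ (enum_rank j)) := vA; rewrite !mxE => {2}<-.
rewrite (reindex (@enum_val T T)) /=; last exact: onW_bij (enum_val_bij _).
by apply: eq_bigr => i _; rewrite enum_valK !mxE !enum_rankK.
Qed.

(** The [N ^ n.+1] monomials with exponents below [N] in [n.+1] polynomials of
    degree at most [d] have degree at most [n.+1 * d * N], so they live in a
    space of dimension at most [(B * N) ^ n] with [B] independent of [N]; for
    [B ^ n < N] there are more of them than this dimension. *)
Lemma algebraic_dependence (R : realType) n (x : nat -> {mpoly R[n]}) d :
  (forall i, (msize (x i) <= d.+1)%N) ->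
  exists N (c : exponent N n.+1 -> R), (exists t, c t != 0) /\
    \sum_t c t *: monomial x t = 0.
Proof.
move=> xd; pose B := (n.+1 * d).+1; pose N := (B ^ n).+1.
pose J := {ffun 'I_n -> 'I_(B * N)}.
have [] := @nontrivial_relation R (exponent N n.+1) J
  (fun t f => (monomial x t)@_[multinom (f i : nat) | i < n]).
  rewrite card_exponent card_ffun !card_ord expnMn expnS ltn_pmul2r ?expn_gt0 //.
move=> c c0 cJ; exists N, c; split=> //; apply/mpolyP => m.
rewrite mcoeff0 raddf_sum.
have [mlt|] := boolP [forall i, (m i < B * N)%N].
  have := cJ [ffun i => Ordinal (forallP mlt i)].
  rewrite [X in mcoeff X](_ : _ = m); last by apply/mnmP=> i; rewrite mnmE ffunE.
  by move=> rel; apply: etrans rel; apply: eq_bigr => t _; exact: mcoeffZ.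
rewrite negb_forall => /existsP[i]; rewrite -leqNgt => mi.
apply: big1 => t _; apply: etrans (mcoeffZ _ _ _) _.
rewrite memN_msupp_eq0 ?mulr0 //.
apply: msize_mdeg_ge; apply: leq_trans (msize_monomial t xd) _.
apply: leq_trans (_ : (m i <= _)%N); last first.
  by rewrite mdegE (bigD1 i) //= leq_addr.
by apply: leq_trans mi; rewrite /B /N; nia.
Qed.

(** A strict chain with [n.+2] terms would provide [n.+1] polynomials in [n]
    variables that are algebraically independent by [monomials_free] and
    dependent by [algebraic_dependence]. *)
Theorem krull_dim_affine_space (R : realType) n (X : set 'rV[R]_n) :
  ~ exists Z, zchain X n.+1 Z.
Proof.
move=> [Z [Zirr ZS]].
have /choice[x xP] : forall i, exists p : {mpoly R[n]}, (i < n.+1)%N ->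
    (forall y, Z i y -> p.@[y 0] = 0) /\ ~ forall y, Z i.+1 y -> p.@[y 0] = 0.
  move=> i; have [ilt|] := boolP (i < n.+1)%N; last by exists 0.
  have [_ /existsNP[y /not_implyP[Zy nZy]]] := ZS i ilt.
  have [Zc _ _] := Zirr i (ltnW ilt).
  have [p pZ py] := zclosed_nmem Zc nZy.
  by exists p => _; split=> // /(_ y Zy)/eqP; apply/negP.
(* [x] is arbitrary beyond the chain, where its degrees may be unbounded *)
pose x' i := if (i < n.+1)%N then x i else 0.
pose d := \max_(i < n.+1) msize (x i).
have xd i : (msize (x' i) <= d.+1)%N.
  rewrite /x'; case: ifP => [ilt|_]; last by rewrite msize0.
  by apply/leqW; apply: (leq_bigmax (Ordinal ilt)).
have [N [c [c0 crel]]] := algebraic_dependence xd.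
apply: (@monomials_free R n N x' Z n.+1 c) => //.
- by move=> i /Zirr[].
- move=> i ilt; rewrite /x' ilt; have [? ?] := xP i ilt; split=> //.
  by case: (ZS i ilt).
- by move=> y _; rewrite crel meval0.
Qed.

(** * Inner product and orthogonal frames of three-space *)

Section Dot.
Variable (F : comNzRingType).
Implicit Types x y z : 'rV[F]_3.

Definition dot x y : F := (x *m y^T) 0 0.

Lemma dotE x y :
  dot x y = x 0 0 * y 0 0 + x 0 1 * y 0 1 + x 0 2%:R * y 0 2%:R.
Proof.
rewrite /dot mxE !big_ord_recr big_ord0 /= add0r !mxE.
by do ![congr (_ + _)|congr (_ * _)|congr (_ _ _)]; exact: val_inj.
Qed.

Lemma dotC x y : dot x y = dot y x. Proof. by rewrite !dotE; ring. Qed.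

Lemma dotDl x y z : dot (x + y) z = dot x z + dot y z.
Proof. by rewrite /dot mulmxDl mxE. Qed.

Lemma dotDr x y z : dot z (x + y) = dot z x + dot z y.
Proof. by rewrite dotC dotDl !(dotC z). Qed.

Lemma dotZl a x y : dot (a *: x) y = a * dot x y.
Proof. by rewrite /dot -scalemxAl mxE. Qed.

Lemma dotZr a x y : dot x (a *: y) = a * dot x y.
Proof. by rewrite dotC dotZl dotC. Qed.

Lemma dotNl x y : dot (- x) y = - dot x y.
Proof. by rewrite -scaleN1r dotZl mulN1r. Qed.

Lemma dotNr x y : dot x (- y) = - dot x y.
Proof. by rewrite dotC dotNl dotC. Qed.

Lemma dot_orthogonal (E : 'M[F]_3) x y :
  E *m E^T = 1%:M -> dot (x *m E) (y *m E) = dot x y.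
Proof. by move=> E1; rewrite /dot trmx_mul mulmxA -(mulmxA x) E1 mulmx1. Qed.

Definition dot_linear := (dotDl, dotDr, dotNl, dotNr, dotZl, dotZr).
End Dot.

Definition row3 (F : comNzRingType) (x y z : F) : 'rV[F]_3 :=
  \row_i nth z [:: x; y] i.

Lemma row3E (F : comNzRingType) (x y z : F) :
  (row3 x y z 0 0 = x) * (row3 x y z 0 1 = y) * (row3 x y z 0 2%:R = z).
Proof. by rewrite !mxE. Qed.

Lemma row3_eta (F : comNzRingType) (x : 'rV[F]_3) :
  x = row3 (x 0 0) (x 0 1) (x 0 2%:R).
Proof.
apply/rowP => -[[|[|[|//]]] ilt]; rewrite mxE /=; congr (x _ _); exact: val_inj.
Qed.

Section Sphere.
Variable R : realType.
Implicit Types (x y v w c : 'rV[R]_3) (r : R).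

Lemma enorm_dot x : enorm x = Num.sqrt (dot x x).
Proof.
by rewrite /enorm /dot mxE; under [in RHS]eq_bigr do rewrite mxE -expr2.
Qed.

Lemma dot_ge0 x : 0 <= dot x x.
Proof. by rewrite dotE -!expr2 !addr_ge0 ?sqr_ge0. Qed.

Lemma dot_eq0 x : (dot x x == 0) = (x == 0).
Proof.
apply/eqP/eqP => [|->]; last by rewrite dotE !mxE !mulr0 !addr0.
rewrite dotE => h; apply/rowP => i; rewrite mxE.
case: i => [[|[|[|//]]] ilt].
- rewrite (_ : Ordinal ilt = 0); [nra|exact: val_inj].
- rewrite (_ : Ordinal ilt = 1); [nra|exact: val_inj].
- rewrite (_ : Ordinal ilt = 2%:R); [nra|exact: val_inj].
Qed.

Lemma sphereP c r x : 0 <= r -> sphere c r x <-> dot (x - c) (x - c) = r ^+ 2.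
Proof.
rewrite /sphere /= enorm_dot => r0; split => [<-|->].
  by rewrite sqr_sqrtr ?dot_ge0.
by rewrite sqrtr_sqr ger0_norm.
Qed.

Lemma zclosed_sphere c r : 0 <= r -> zclosed (sphere c r).
Proof.
move=> r0; pose X (i : 'I_3) : {mpoly R[3]} := 'X_i - (c 0 i)%:MP.
pose p := X 0 * X 0 + X 1 * X 1 + X 2%:R * X 2%:R - (r ^+ 2)%:MP.
rewrite (_ : sphere c r = [set x | p.@[x 0] = 0]); first exact: zclosed_mpoly.
apply/seteqP; split => x /=; rewrite /p mevalB !mevalD !mevalM mevalC;
  rewrite !mevalB !mevalXU !mevalC.
  by move=> /(sphereP _ _ r0); rewrite dotE !mxE => ->; rewrite subrr.
by move=> /subr0_eq h; apply/(sphereP _ _ r0); rewrite dotE !mxE.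
Qed.

Lemma dot_axis m x : dot (row3 0 0 m) x = m * x 0 2%:R.
Proof. by rewrite dotE !row3E; ring. Qed.

Lemma sqr_enorm x : enorm x ^+ 2 = dot x x.
Proof. by rewrite enorm_dot sqr_sqrtr ?dot_ge0. Qed.

Lemma enorm_ge0 x : 0 <= enorm x.
Proof. by rewrite enorm_dot sqrtr_ge0. Qed.

Lemma enorm_eq0 x : (enorm x == 0) = (x == 0).
Proof. by rewrite -sqrf_eq0 sqr_enorm dot_eq0. Qed.

(** The reflection in the bisecting plane of [v] and of the vector of the same
    length on the third axis. *)
Lemma householder v :
  exists E : 'M[R]_3, E *m E^T = 1%:M /\ v = row3 0 0 (enorm v) *m E.
Proof.
set m := enorm v; set z := row3 0 0 m; have [vz|vz] := eqVneq v z.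
  by exists 1%:M; rewrite trmx1 !mulmx1.
have : dot (v - z) (v - z) != 0 by rewrite dot_eq0 subr_eq0.
move hE : (v - z) => h h0.
have dvv : dot v v = dot z z.
  by rewrite dot_axis row3E -expr2 /m sqr_enorm.
have hhT : h *m h^T = (dot h h)%:M by rewrite [LHS]mx11_scalar.
exists (1%:M - (2 / dot h h) *: (h^T *m h)); split.
  rewrite [X in _ *m X](_ : _ = 1%:M - (2 / dot h h) *: (h^T *m h)); last first.
    apply/matrixP => i j; rewrite !mxE eq_sym !big_ord1 !mxE.
    by congr (_ - _ * _); rewrite mulrC.
  rewrite mulmxBl mul1mx mulmxBr mulmx1 -scalemxAl -scalemxAr.
  rewrite [h^T *m h *m _]mulmxA -(mulmxA _ h) hhT mul_mx_scalar -scalemxAl.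
  by rewrite !scalerA; apply/matrixP => i j; rewrite !mxE big_ord1 !mxE; field.
rewrite mulmxBr mulmx1 -scalemxAr mulmxA.
rewrite (_ : z *m h^T = (dot z h)%:M); last by rewrite [LHS]mx11_scalar.
rewrite mul_scalar_mx scalerA.
have -> : 2 / dot h h * dot z h = -1.
  have hh : dot h h = - 2 * dot z h.
    by rewrite -hE !(dotDl, dotDr, dotNl, dotNr) (dotC v z) dvv; ring.
  by move: h0; rewrite hh => h0; field; move: h0; rewrite mulf_eq0 => /norP[].
by rewrite scaleN1r opprK -hE addrC subrK.
Qed.

End Sphere.

(** * Circles and the irreducibility of the sphere *)

(** With [t] the tangent of a quarter of the angle, these are the cosine and the
    sine; the usual formulas, in the tangent of half the angle, miss the point
    [(-1, 0)] of the circle. They are stated over any field because they serve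
    both as functions on the reals and as elements of the field of rational
    functions. *)
Definition cosr (F : fieldType) (t : F) : F :=
  ((1 - t ^+ 2) ^+ 2 - (2 * t) ^+ 2) / (1 + t ^+ 2) ^+ 2.

Definition sinr (F : fieldType) (t : F) : F :=
  2 * (1 - t ^+ 2) * (2 * t) / (1 + t ^+ 2) ^+ 2.

Lemma cosr2Dsinr2 (F : fieldType) (t : F) :
  1 + t ^+ 2 != 0 -> cosr t ^+ 2 + sinr t ^+ 2 = 1.
Proof. by move=> t1; rewrite /cosr /sinr; field. Qed.

Section Circles.
Variable R : realType.
Implicit Types (x y v w c b : 'rV[R]_3) (r s t : R).

Lemma trig_den_neq0 t : 1 + t ^+ 2 != 0.
Proof. by rewrite gt_eqF // ltr_pwDl ?ltr01 ?sqr_ge0. Qed.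

(** A point [(k, s)] of the circle has a square root [(h, l)] with [0 <= h],
    which the formulas in the tangent [l / (1 + h)] do reach. *)
Lemma cosr_sinr_surj (k s : R) : k ^+ 2 + s ^+ 2 = 1 ->
  exists t, cosr t = k /\ sinr t = s.
Proof.
move=> ks1; have [h [l [h0 hk hl ls]]] : exists h l,
    [/\ 0 <= h, h ^+ 2 = (1 + k) / 2, 2 * h * l = s & l ^+ 2 = (1 - k) / 2].
  have k1 : 0 <= (1 + k) / 2 by nra.
  have [k0|k0] := eqVneq (1 + k) 0.
    by exists 0, 1; split; nra.
  have := sqr_sqrtr k1; have := sqrtr_ge0 ((1 + k) / 2).
  move: (Num.sqrt _) => h h0 h2; exists h, (s / (2 * h)).
  have hN0 : h != 0.
    by apply: contra k0 => /eqP hE; apply/eqP; move: h2; rewrite hE; lra.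
  split=> //; first by field.
  have -> : (s / (2 * h)) ^+ 2 = s ^+ 2 / (4 * h ^+ 2) by field.
  have -> : s ^+ 2 = 1 - k ^+ 2 by rewrite -ks1; ring.
  by rewrite h2; field.
have h1 : 1 + h != 0 by rewrite gt_eqF // ltr_pwDl.
exists (l / (1 + h)); rewrite /cosr /sinr.
have -> : (l / (1 + h)) ^+ 2 = (1 - h) / (1 + h).
  have -> : (l / (1 + h)) ^+ 2 = l ^+ 2 / (1 + h) ^+ 2 by field.
  have -> : l ^+ 2 = (1 - h) * (1 + h) by rewrite -subr_sqr expr1n hk ls; field.
  by field.
have -> : 1 + (1 - h) / (1 + h) = 2 / (1 + h) by field.
split; last by rewrite -hl; field.
have -> : k = h ^+ 2 - l ^+ 2 by rewrite hk ls; field.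
by field.
Qed.

Lemma curve_circle b x w : exists num (den : {poly R}),
  (forall t, den.[t] != 0) /\
  forall t, curve num den t = b + cosr t *: x + sinr t *: w.
Proof.
pose D : {poly R} := 1 + 'X ^+ 2.
exists (fun i => (b 0 i)%:P * D ^+ 2
  + (x 0 i)%:P * ((1 - 'X ^+ 2) ^+ 2 - (2%:P * 'X) ^+ 2)
  + (w 0 i)%:P * (2%:P * (1 - 'X ^+ 2) * (2%:P * 'X))), (D ^+ 2).
have DE t : (D ^+ 2).[t] = (1 + t ^+ 2) ^+ 2 by rewrite !hornerE.
split=> t; first by rewrite DE expf_neq0 ?trig_den_neq0.
apply/rowP => i; rewrite !mxE DE /D.
rewrite !(hornerD, hornerN, hornerM, hornerC, hornerX, horner_exp) /cosr /sinr.
field.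
exact: trig_den_neq0.
Qed.

Lemma ex_orthonormal x : dot x x = 1 -> exists2 w, dot w w = 1 & dot x w = 0.
Proof.
move=> x1; have [E [E1 xE]] := householder x.
exists (row3 1 0 0 *m E); first by rewrite dot_orthogonal // dotE !row3E; ring.
by rewrite xE dot_orthogonal // dot_axis row3E mulr0.
Qed.

Lemma ex_great_circle x y : dot x x = 1 -> dot y y = 1 ->
  exists w k s, [/\ dot w w = 1, dot x w = 0, k ^+ 2 + s ^+ 2 = 1 &
                    y = k *: x + s *: w].
Proof.
move=> x1 y1; pose k := dot x y.
(* [y'] is the component of [y] orthogonal to [x]; if it vanishes, then [y] is
   [x] or [-x], and any great circle through [x] will do *)
move yE : (y - k *: x) => y'.
have yD : y = k *: x + y' by rewrite -yE addrC subrK.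
have xy' : dot x y' = 0 by rewrite -yE !dot_linear x1 /k; ring.
have y'2 : k ^+ 2 + dot y' y' = 1.
  by rewrite -y1 yD !dot_linear x1 (dotC y') xy'; ring.
have [y0|y0] := eqVneq y' 0.
  have [w w1 xw] := ex_orthonormal x1.
  exists w, k, 0; split=> //; last by rewrite scale0r addr0 yD y0 addr0.
  by rewrite expr0n addr0 -y'2 y0 -[0 in RHS](scale0r 0) dotZl mul0r addr0.
have e2 := sqr_enorm y'; have e0 : enorm y' != 0 by rewrite enorm_eq0.
exists ((enorm y')^-1 *: y'), k, (enorm y'); split.
- by rewrite !dot_linear -e2; field.
- by rewrite dotZr xy' mulr0.
- by rewrite e2.
- by rewrite scalerA mulfV // scale1r.
Qed.

Definition circle c r x w : set 'rV[R]_3 :=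
  [set z | exists k s, k ^+ 2 + s ^+ 2 = 1 /\ z = c + r *: (k *: x + s *: w)].

Lemma circle_joined (Z : set 'rV[R]_3) c r x w z z' :
  circle c r x w `<=` Z -> circle c r x w z -> circle c r x w z' ->
  joined_by_curve Z z z'.
Proof.
move=> CZ [k [s [ks ->]]] [k' [s' [ks' ->]]].
have [num [den [den0 cE]]] := curve_circle c (r *: x) (r *: w).
have cE' t : curve num den t = c + r *: (cosr t *: x + sinr t *: w).
  by rewrite cE scalerDr !scalerA !(mulrC r) addrA.
exists num, den; split=> // [t||].
- rewrite cE'; apply: CZ; exists (cosr t), (sinr t); split=> //.
  exact: cosr2Dsinr2 (trig_den_neq0 t).
- by have [t [<- <-]] := cosr_sinr_surj ks; exists t; rewrite cE'.
- by have [t [<- <-]] := cosr_sinr_surj ks'; exists t; rewrite cE'.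
Qed.

Lemma circle_sphere c r x w : 0 <= r -> dot x x = 1 -> dot w w = 1 ->
  dot x w = 0 -> circle c r x w `<=` sphere c r.
Proof.
move=> r0 x1 w1 xw _ [k [s [ks ->]]]; apply/(sphereP _ _ r0).
rewrite addrAC subrr add0r !dot_linear x1 w1 (dotC w) xw.
by transitivity (r ^+ 2 * (k ^+ 2 + s ^+ 2)); [ring|rewrite ks mulr1].
Qed.

(** Any two points of a sphere lie on a common great circle, which is a rational
    curve. *)
Lemma zirreducible_sphere c r : 0 < r -> zirreducible (sphere c r).
Proof.
move=> r0; have r0' := ltW r0; have rN0 := lt0r_neq0 r0.
apply: zirreducible_curves.
  exists (c + r *: delta_mx 0 0); apply/(sphereP _ _ r0').
  by rewrite addrAC subrr add0r dotE !mxE /=; ring.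
move=> z z' /(sphereP _ _ r0') zS /(sphereP _ _ r0') z'S.
pose u := r^-1 *: (z - c); pose u' := r^-1 *: (z' - c).
have u1 : dot u u = 1 by rewrite !dotZl !dotZr zS; field.
have u'1 : dot u' u' = 1 by rewrite !dotZl !dotZr z'S; field.
have uE : z = c + r *: u by rewrite scalerA mulfV // scale1r addrC subrK.
have u'E : z' = c + r *: u' by rewrite scalerA mulfV // scale1r addrC subrK.
have [w [k [s [w1 xw ks u'D]]]] := ex_great_circle u1 u'1.
apply: (circle_joined (circle_sphere r0' u1 w1 xw)).
  by exists 1, 0; split; [ring|rewrite scale1r scale0r addr0].
by exists k, s; rewrite -u'D.
Qed.

End Circles.

(** * The dimension of the sphere *)

Section SphereDim.
Variable R : realType.
Implicit Types (x y v w c b : 'rV[R]_3) (r s t : R).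

Lemma zclosed_point n (a : 'rV[R]_n) : zclosed [set a].
Proof.
exists [set p | exists i, p = 'X_i - (a 0 i)%:MP]; apply/seteqP; split=> x /=.
  by move=> -> p [i ->]; rewrite mevalB mevalXU mevalC subrr.
move=> xa; apply/rowP=> i; apply/subr0_eq.
by rewrite -(xa _ (ex_intro _ i erefl)) mevalB mevalXU mevalC.
Qed.

Lemma zirreducible_point n (a : 'rV[R]_n) : zirreducible [set a].
Proof.
split=> [|A B _ _ aAB]; first by exists a.
by have [aA|aB] := aAB a erefl; [left|right] => _ ->.
Qed.

Lemma zclosed_equator c r : 0 <= r ->
  zclosed (circle c r (delta_mx 0 0) (delta_mx 0 1)).
Proof.
move=> r0; pose p : {mpoly R[3]} := 'X_2%:R - (c 0 2%:R)%:MP.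
rewrite (_ : circle _ _ _ _ = sphere c r `&` [set x | p.@[x 0] = 0]).
  exact: zclosedI (zclosed_sphere _ r0) (zclosed_mpoly _).
have pE x : p.@[x 0] = x 0 2%:R - c 0 2%:R by rewrite mevalB mevalXU mevalC.
apply/seteqP; split=> x /=; rewrite pE.
  move=> xC; split; last first.
    by case: xC => k [s [_ ->]]; rewrite !mxE /=; ring.
  by move: xC; apply: circle_sphere => //; rewrite dotE !mxE /=; ring.
move=> [/(sphereP _ _ r0)]; rewrite dotE !mxE => xS x2.
have [r00|rN0] := eqVneq r 0.
  exists 1, 0; split; first by ring.
  rewrite r00 scale0r addr0; apply/eqP; rewrite -subr_eq0 -dot_eq0 dotE !mxE.
  by rewrite xS r00 expr0n.
exists ((x 0 0 - c 0 0) / r), ((x 0 1 - c 0 1) / r); split.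
  apply: (mulfI (expf_neq0 2 rN0)); rewrite mulr1 -[in RHS]xS x2.
  by field.
apply/rowP => i; rewrite !mxE /=; move: x2.
case: i => [[|[|[|//]]] ilt] /=; rewrite ?(mulr0, mulr1, add0r, addr0).
- rewrite (_ : Ordinal ilt = 0); [by move=> _; field|exact: val_inj].
- rewrite (_ : Ordinal ilt = 1); [by move=> _; field|exact: val_inj].
- by rewrite (_ : Ordinal ilt = 2%:R); [move=> /subr0_eq|exact: val_inj].
Qed.

(** A point, a circle through it and the sphere form a chain of length two. A
    chain of length three in the sphere would extend to one of length four in
    three-space by appending the whole space. *)
Lemma zdim_sphere (S : set 'rV[R]_3) c r :
  0 < r -> zclosure S = sphere c r -> zdim S 2.
Proof.
move=> r0 SE; have r0' := ltW r0; rewrite /zdim SE; split; last first.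
  move=> [Z [Zirr ZS]]; apply: (@krull_dim_affine_space R 3 setT).
  exists (fun i => if (i <= 3)%N then Z i else setT); split => i.
    case: ifP => [/Zirr[] //|_ _]; split=> //; last exact: zirreducible_setT.
    by exists set0; apply/seteqP; split=> // x _ p [].
  rewrite ltnS => i3; rewrite i3; move: i3; rewrite leq_eqVlt => /orP[/eqP ->|].
    split=> // ZT.
    have [_ _ Z3] := Zirr 3%N (leqnn _).
    have /(sphereP _ _ r0') := Z3 _ (ZT c I).
    by rewrite subrr dotE !mxE => h; nra.
  by move=> i3; rewrite i3; apply: ZS.
pose C := circle c r (delta_mx 0 0) (delta_mx 0 1).
have CS : C `<=` sphere c r.
  by apply: circle_sphere => //; rewrite dotE !mxE /=; ring.
pose z (k s : R) : 'rV[R]_3 := c + r *: (k *: delta_mx 0 0 + s *: delta_mx 0 1).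
have Cz k s : k ^+ 2 + s ^+ 2 = 1 -> C (z k s) by exists k, s.
have C1 : C (z 1 0) by apply: Cz; ring.
exists (fun i => if i is j.+1 then if j is 0%N then C else sphere c r
  else [set z 1 0]); split.
  move=> [|[|[|//]]] _; split=> //.
  - exact: zclosed_point.
  - exact: zirreducible_point.
  - by move=> _ ->; apply: CS.
  - exact: zclosed_equator.
  - apply: zirreducible_curves; first by exists (z 1 0).
    by move=> x y Cx Cy; exact: circle_joined Cx Cy.
  - exact: zclosed_sphere.
  - exact: zirreducible_sphere.
move=> [|[|//]] _; split=> //; first by move=> _ ->.
  have C2 : C (z (-1) 0) by apply: Cz; ring.
  move=> /(_ _ C2) /= /rowP/(_ 0); by rewrite !mxE /= => h; nra.
have S3 : sphere c r (c + r *: delta_mx 0 2%:R).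
  by apply/(sphereP _ _ r0'); rewrite addrAC subrr add0r dotE !mxE /=; ring.
move=> /(_ _ S3) [k [s [_ /rowP/(_ 2%:R)]]]; by rewrite !mxE /= => h; nra.
Qed.

End SphereDim.

(** * Values of rational functions *)

HB.instance Definition _ (R : realType) :=
  GRing.RMorphism.copy (@ratC R) (@tofrac {mpoly R[2]} \o @mpolyC 2 R).

Section Ratval.
Variable R : realType.
Implicit Types (g h : ratfun R) (a b : 'rV[R]_2) (y z : R).

Lemma ratval_tofrac (p : {mpoly R[2]}) a : ratval (tofrac p) a p.@[a 0].
Proof.
by exists p, 1; rewrite meval1 oner_eq0 tofrac1 !divr1.
Qed.

Lemma ratval_const c a : ratval (ratC c) a c.
Proof. by rewrite -[X in ratval _ _ X](mevalC (a 0)); exact: ratval_tofrac. Qed.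

Lemma meval_neq0 (q : {mpoly R[2]}) a : q.@[a 0] != 0 -> q != 0.
Proof. by apply: contraNneq => ->; rewrite meval0. Qed.

(** Values are compatible with the field operations, so a value of an expression
    is computed by following its syntax. *)
Lemma ratvalD g h a y z :
  ratval g a y -> ratval h a z -> ratval (g + h) a (y + z).
Proof.
move=> [p [q [qa -> ->]]] [p' [q' [qa' -> ->]]].
exists (p * q' + p' * q), (q * q'); split.
- by rewrite mevalM mulf_neq0.
- rewrite tofracD !tofracM addf_div ?tofrac_eq0 ?(meval_neq0 qa) //.
  exact: meval_neq0 qa'.
- by rewrite mevalD !mevalM addf_div.
Qed.

Lemma ratvalM g h a y z :
  ratval g a y -> ratval h a z -> ratval (g * h) a (y * z).
Proof.
move=> [p [q [qa -> ->]]] [p' [q' [qa' -> ->]]].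
exists (p * p'), (q * q'); split; last by rewrite !mevalM mulf_div.
  by rewrite mevalM mulf_neq0.
by rewrite !tofracM mulf_div.
Qed.

Lemma ratvalN g a y : ratval g a y -> ratval (- g) a (- y).
Proof.
by move=> [p [q [qa -> ->]]]; exists (- p), q; rewrite tofracN mevalN !mulNr.
Qed.

Lemma ratvalB g h a y z :
  ratval g a y -> ratval h a z -> ratval (g - h) a (y - z).
Proof. by move=> gy hz; apply: ratvalD gy _; apply: ratvalN. Qed.

Lemma ratvalX g a y n : ratval g a y -> ratval (g ^+ n) a (y ^+ n).
Proof.
move=> gy; elim: n => [|n IH]; last by rewrite !exprS; apply: ratvalM.
by rewrite !expr0 -(rmorph1 (@ratC R)); exact: ratval_const.
Qed.

Lemma ratvalV g a y : ratval g a y -> y != 0 -> ratval g^-1 a y^-1.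
Proof.
move=> [p [q [qa -> ->]]]; rewrite mulf_eq0 invr_eq0 (negPf qa) orbF => pa.
by exists q, p; rewrite !invf_div.
Qed.

Lemma ratval_div g h a y z :
  ratval g a y -> ratval h a z -> z != 0 -> ratval (g / h) a (y / z).
Proof. by move=> gy hz z0; apply: ratvalM gy _; apply: ratvalV. Qed.

Lemma ratval_uniq g a y z : ratval g a y -> ratval g a z -> y = z.
Proof.
move=> [p [q [qa -> ->]]] [p' [q' [qa' /eqP]]].
rewrite eqr_div ?tofrac_eq0 ?(meval_neq0 qa) ?(meval_neq0 qa') //.
rewrite -!tofracM tofrac_eq => /eqP pq ->; apply/eqP; rewrite eqr_div //.
by rewrite -!mevalM pq.
Qed.

Lemma ratval_neq0 g a y : ratval g a y -> y != 0 -> g != 0.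
Proof.
move=> gy; apply: contraNneq => g0; apply/eqP; apply: ratval_uniq gy _.
by rewrite g0 -(rmorph0 (@ratC R)); exact: ratval_const.
Qed.

Lemma ratval_sum n (g : 'I_n -> ratfun R) a (y : 'I_n -> R) :
  (forall i, ratval (g i) a (y i)) -> ratval (\sum_i g i) a (\sum_i y i).
Proof.
move=> gy; elim/big_ind2: _ => [|? ? ? ?|//]; last exact: ratvalD.
by rewrite -(rmorph0 (@ratC R)); exact: ratval_const.
Qed.

Lemma ratval_open g a y : ratval g a y -> exists2 D : {mpoly R[2]},
  D.@[a 0] != 0 & forall b, D.@[b 0] != 0 -> exists z, ratval g b z.
Proof.
by move=> [p [q [qa gE _]]]; exists q => // b qb; exists (p.@[b 0] / q.@[b 0]), p, q.
Qed.

Lemma ratval_open_neq0 g a y : ratval g a y -> y != 0 ->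
  exists2 D : {mpoly R[2]}, D.@[a 0] != 0 &
    forall b, D.@[b 0] != 0 -> exists2 z, ratval g b z & z != 0.
Proof.
move=> gy y0.
have [D Da DP] := ratval_open gy; have [D' Da' DP'] := ratval_open (ratvalV gy y0).
exists (D * D') => [|b]; first by rewrite mevalM mulf_neq0.
rewrite mevalM mulf_eq0 => /norP[/DP[z gz] /DP'[z' gz']]; exists z => //.
apply/eqP => z0; have := ratvalM gz gz'.
rewrite mulfV ?(ratval_neq0 gy) // z0 mul0r -(rmorph1 (@ratC R)).
by move=> /(ratval_uniq (ratval_const _ _))/eqP; rewrite oner_eq0.
Qed.

Definition ratvals n (g : 'rV[ratfun R]_n) a (y : 'rV[R]_n) :=
  forall i, ratval (g 0 i) a (y 0 i).

Lemma ratvals_const n (x : 'rV[R]_n) a : ratvals (map_mx (@ratC R) x) a x.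
Proof. by move=> i; rewrite mxE; exact: ratval_const. Qed.

Lemma ratvalsD n (g h : 'rV_n) a (y z : 'rV_n) :
  ratvals g a y -> ratvals h a z -> ratvals (g + h) a (y + z).
Proof. by move=> gy hz i; rewrite !mxE; exact: ratvalD. Qed.

Lemma ratvalsB n (g h : 'rV_n) a (y z : 'rV_n) :
  ratvals g a y -> ratvals h a z -> ratvals (g - h) a (y - z).
Proof. by move=> gy hz i; rewrite !mxE; exact: ratvalB. Qed.

Lemma ratvalsZ n g (h : 'rV_n) a y (z : 'rV_n) :
  ratval g a y -> ratvals h a z -> ratvals (g *: h) a (y *: z).
Proof. by move=> gy hz i; rewrite !mxE; exact: ratvalM. Qed.

Lemma ratvals_mul n (g : 'rV_n) a (y : 'rV_n) (E : 'M[R]_n) :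
  ratvals g a y -> ratvals (g *m map_mx (@ratC R) E) a (y *m E).
Proof.
move=> gy i; rewrite !mxE; apply: ratval_sum => j; apply: ratvalM => //.
by rewrite mxE; exact: ratval_const.
Qed.

Lemma ratval_dot (g h : 'rV_3) a (y z : 'rV_3) :
  ratvals g a y -> ratvals h a z -> ratval (dot g h) a (dot y z).
Proof.
move=> gy hz; rewrite /dot !mxE; apply: ratval_sum => i.
by rewrite !mxE; apply: ratvalM.
Qed.

Lemma ratvals_uniq n (g : 'rV_n) a (y z : 'rV_n) :
  ratvals g a y -> ratvals g a z -> y = z.
Proof. by move=> gy gz; apply/rowP => i; apply: ratval_uniq (gy i) (gz i). Qed.

Lemma ratvals_open n (g : 'rV_n) a (y : 'rV_n) : ratvals g a y ->
  exists2 D : {mpoly R[2]}, D.@[a 0] != 0 &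
    forall b, D.@[b 0] != 0 -> exists z : 'rV_n, ratvals g b z.
Proof.
move=> gy; have /choice[D DP] : forall i, exists D : {mpoly R[2]},
    D.@[a 0] != 0 /\ forall b, D.@[b 0] != 0 -> exists z, ratval (g 0 i) b z.
  by move=> i; have [D Da Db] := ratval_open (gy i); exists D.
exists (\prod_i D i) => [|b]; rewrite (big_morph (meval _) (mevalM _) (meval1 _)).
  by apply/prodf_neq0 => i _; have [] := DP i.
move=> /prodf_neq0 Db; have /choice[z zP] : forall i, exists z, ratval (g 0 i) b z.
  by move=> i; have [_] := DP i; apply; apply: Db.
by exists (\row_i z i) => i; rewrite mxE.
Qed.

Lemma line_restriction (p : {mpoly R[2]}) a b :
  exists h : {poly R}, forall t, h.[t] = p.@[(a + t *: (b - a)) 0].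
Proof.
have [h hE] := restrict_to_curve p (fun i => (a 0 i)%:P + (b 0 i - a 0 i)%:P * 'X) 1.
exists h => t; rewrite hE ?hornerC ?oner_eq0 // expr1n mul1r.
apply: meval_eq => i.
by rewrite !mxE !(hornerD, hornerM, hornerC, hornerX) divr1 mulrC.
Qed.

(** To show that the image of [g] lies in the closure of [S], it suffices to look
    at the parameters outside of a curve [D = 0]. This matters because [g] may
    be defined at parameters where the functions it is composed of are not. The
    line from such a parameter [a] to [a0] meets the curve in finitely many
    points, and its image under [g] is a rational curve to which
    [curve_zclosure] applies. *)
Lemma ratimage_generic (g : 'rV[ratfun R]_3) (S : set 'rV[R]_3)
    (D : {mpoly R[2]}) a0 :
  D.@[a0 0] != 0 ->
  (forall a x, D.@[a 0] != 0 -> ratvals g a x -> S x) ->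
  ratimage g `<=` zclosure S.
Proof.
move=> Da0 gS x [a gx].
have /choice[p /choice[q pq]] := gx.
have /choice[P PE] := fun i => line_restriction (p i) a a0.
have /choice[Q QE] := fun i => line_restriction (q i) a a0.
have [e eE] := line_restriction D a a0.
(* the three coordinates of [g] along the line, over a common denominator *)
pose num i := P i * \prod_(j < 3 | j != i) Q j; pose den := \prod_(j < 3) Q j.
have curveE t : den.[t] != 0 ->
    forall i, (Q i).[t] != 0 /\ curve num den t 0 i = (P i).[t] / (Q i).[t].
  rewrite horner_prod => d0 i; rewrite mxE hornerM !horner_prod.
  move: d0; rewrite (bigD1 i) //= mulf_eq0 => /norP[Q0 d0]; split=> //.
  by rewrite -mulf_div mulfV // mulr1.
have line0 : a + 0 *: (a0 - a) = a by rewrite scale0r addr0.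
have den0 : den.[0] != 0.
  rewrite horner_prod; apply/prodf_neq0 => i _; rewrite QE line0.
  by have [] := pq i.
rewrite (_ : x = curve num den 0); last first.
  apply/rowP=> i; have [_ ->] := curveE _ den0 i.
  by rewrite PE QE line0; have [] := pq i.
apply: (@curve_zclosure _ _ _ _ _ [set t | e.[t] != 0]) => //.
  apply: poly_determining_cofinite; apply: contraNneq Da0 => e0.
  by have := eE 1; rewrite e0 horner0 scale1r addrC subrK => <-.
move=> t /= et dt; apply: (gS (a + t *: (a0 - a))); first by rewrite -eE.
move=> i; have [Q0 ->] := curveE _ dt i; rewrite PE QE.
by have [_ gE _] := pq i; exists (p i), (q i); rewrite -QE.
Qed.

End Ratval.

(** * Conchoids from a parametrization with rational distance *)

Section RadialProjection.
Variable R : realType.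
Implicit Types (v x z : 'rV[R]_3) (m r t : R).

Lemma ex_direction v : exists2 e, dot e e = 1 & v = enorm v *: e.
Proof.
have [E [E1 vE]] := householder v; exists (row3 0 0 1 *m E).
  by rewrite dot_orthogonal // dotE !row3E; ring.
rewrite {1}vE scalemxAl; congr (_ *m _).
by rewrite [RHS]row3_eta !mxE /= mulr0 mulr1.
Qed.

Lemma trig_near0 m r t : 0 <= m -> 0 < r -> 0 < t < r / (4 * (m + r)) ->
  0 < cosr t /\ (m * sinr t) ^+ 2 < r ^+ 2.
Proof.
move=> m0 r0 /andP[t0]; rewrite ltr_pdivlMr; last by lra.
move=> tr; have t4 : 4 * t < 1 by nra.
have dgt0 : 0 < (1 + t ^+ 2) ^+ 2 by rewrite exprn_gt0 // ltr_pwDl ?sqr_ge0.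
split; first by rewrite /cosr divr_gt0 //; nra.
have s0 : 0 <= sinr t by rewrite /sinr divr_ge0 ?(ltW dgt0) //; nra.
have s4 : sinr t <= 4 * t by rewrite /sinr ler_pdivrMr //; nra.
have ms0 : 0 <= m * sinr t by exact: mulr_ge0.
rewrite ltr_pXn2r ?nnegrE ?(ltW r0) //.
have : m * sinr t <= m * (4 * t) by rewrite ler_wpM2l.
nra.
Qed.

Lemma enormZ (a : R) x : 0 <= a -> dot x x = 1 -> enorm (a *: x) = a.
Proof.
by move=> a0 x1; rewrite enorm_dot !dot_linear x1 mulr1 sqrtr_sqr ger0_norm.
Qed.

(** The directions of the points of a sphere with centre [v] form a dense subset
    of the unit sphere, although they fill only a cone when the origin is
    outside of the sphere: they contain all directions close to the direction
    [e] of [v], hence an arc of every great circle through [e]. *)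
Lemma radial_zdense v x r (S : set 'rV[R]_3) : 0 < r ->
  (forall z, dot (z - v) (z - v) = r ^+ 2 -> z != 0 -> S ((enorm z)^-1 *: z)) ->
  dot x x = 1 -> zclosure S x.
Proof.
move=> r0 Sz x1; have [e e1 vE] := ex_direction v.
move: (enorm v) (enorm_ge0 v) vE => m m0 vE.
have [w [k [s [w1 ew ks xE]]]] := ex_great_circle e1 x1.
have [num [den [den0 cE]]] := curve_circle 0 e w.
have [t0 [tk ts]] := cosr_sinr_surj ks.
have -> : x = curve num den t0 by rewrite cE add0r tk ts -xE.
apply: (curve_zclosure (poly_determining_interval _)) => [|//|].
  by apply: (@divr_gt0 _ r (4 * (m + r))) => //; lra.
move=> t /= /(trig_near0 m0 r0) [k0 sr] _; rewrite cE add0r.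
have cs1 := cosr2Dsinr2 (trig_den_neq0 t).
move: (cosr t) (sinr t) k0 sr cs1 => {ks xE tk ts} {}k {}s k0 sr cs1.
(* the point of the sphere in the direction [y] is [p *: y], with [p] the larger
   root of [p ^+ 2 - 2 * m * k * p + m ^+ 2 - r ^+ 2] *)
set y := _ + _; pose q := Num.sqrt (r ^+ 2 - (m * s) ^+ 2).
have q0 : 0 < q by rewrite sqrtr_gt0 subr_gt0.
have q2 : q ^+ 2 = r ^+ 2 - (m * s) ^+ 2 by rewrite sqr_sqrtr // subr_ge0 ltW.
pose p := m * k + q; have p0 : 0 < p by rewrite /p; nra.
have y1 : dot y y = 1.
  by rewrite -[RHS]cs1 /y !dot_linear (dotC w) e1 w1 ew; ring.
have ey : dot e y = k by rewrite /y !dot_linear e1 ew; ring.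
have := Sz (p *: y); rewrite enormZ ?(ltW p0) // scalerA mulVf ?gt_eqF //.
rewrite scale1r; apply.
  rewrite vE !(dotDl, dotDr, dotNl, dotNr) !(dotZl, dotZr) (dotC y) ey e1 y1.
  transitivity (q ^+ 2 - m ^+ 2 * k ^+ 2 + m ^+ 2); first by rewrite /p; ring.
  by rewrite q2; have -> : k ^+ 2 = 1 - s ^+ 2; [rewrite -cs1|]; ring.
by rewrite -dot_eq0 !(dotZl, dotZr) y1 mulr1 mulf_neq0 ?gt_eqF.
Qed.

End RadialProjection.

Section RationalDistance.
Variables (R : realType) (c O : 'rV[R]_3) (r : R).
Variables (rho : ratfun R) (f : 'rV[ratfun R]_3).
Local Notation v := (c - O).
Local Notation k := (rho^-1 *: f).

Hypothesis r0 : 0 < r.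
Hypothesis f_norm : dot f f = rho ^+ 2.
Hypothesis f_on_sphere :
  dot (f - map_mx (@ratC R) v) (f - map_mx (@ratC R) v) = ratC r ^+ 2.
Hypothesis f_surj : forall z, dot (z - v) (z - v) = r ^+ 2 ->
  exists a, ratval rho a (enorm z) /\ ratvals f a z.

Lemma ex_value_neq0 :
  exists a z, [/\ ratval rho a (enorm z), ratvals f a z & z != 0].
Proof.
have [e e1 vE] := ex_direction v; have m0 := enorm_ge0 v.
have [|a [ra fa]] := f_surj (z := (enorm v + r) *: e).
  by rewrite [X in _ - X]vE -scalerBl addrAC subrr add0r !dot_linear e1; ring.
exists a, ((enorm v + r) *: e); split=> //.
by rewrite -dot_eq0 !dot_linear e1 mulr1 mulf_neq0 ?gt_eqF ?ltr_wpDl.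
Qed.

Lemma rho_neq0 : rho != 0.
Proof.
have [a [z [rz _ z0]]] := ex_value_neq0.
by apply: ratval_neq0 rz _; rewrite enorm_eq0.
Qed.

Lemma rho_k : rho *: k = f.
Proof. by rewrite scalerA mulfV ?rho_neq0 // scale1r. Qed.

Lemma value_sphere a z : ratvals f a z -> sphere c r (O + z).
Proof.
move=> fz; apply/(sphereP _ _ (ltW r0)).
have -> : O + z - c = z - v by rewrite opprB addrCA addrA.
have fv := ratvalsB fz (ratvals_const v a).
apply: ratval_uniq (ratval_dot fv fv) _; rewrite f_on_sphere.
exact/ratvalX/ratval_const.
Qed.

Lemma sphere_value x : sphere c r x ->
  exists a, ratval rho a (enorm (x - O)) /\ ratvals f a (x - O).
Proof.
by move=> /(sphereP _ _ (ltW r0)) xS; apply: f_surj; rewrite opprB addrA subrK.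
Qed.

Lemma k_value z a : ratval rho a (enorm z) -> ratvals f a z -> z != 0 ->
  ratvals k a ((enorm z)^-1 *: z).
Proof.
by move=> rz fz z0; apply: ratvalsZ fz; apply: ratvalV rz _; rewrite enorm_eq0.
Qed.

Lemma translate_value g a x : ratvals (map_mx (@ratC R) O + g) a x ->
  ratvals g a (x - O).
Proof.
move=> gx; have := ratvalsB gx (ratvals_const O a).
by rewrite addrAC subrr add0r.
Qed.

Lemma rational_distance_polar : polar_representation O (sphere c r) rho k.
Proof.
have kS : ratimage k `<=` sphere 0 1.
  move=> x [a kx]; apply/(sphereP _ _ ler01); rewrite subr0 expr1n.
  apply: ratval_uniq (ratval_dot kx kx) _.
  rewrite dotZl dotZr f_norm mulrA -expr2 exprVn mulVf ?expf_neq0 ?rho_neq0 //.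
  by rewrite -(rmorph1 (@ratC R)); exact: ratval_const.
have Sk : sphere 0 1 `<=` zclosure (ratimage k).
  move=> x /(sphereP _ _ ler01); rewrite subr0 expr1n => x1.
  apply: (radial_zdense (v := v) r0) => // z zr zN0.
  by have [a [rz fz]] := f_surj zr; exists a; exact: k_value.
have fS : ratimage (polar_map O rho k) `<=` sphere c r.
  rewrite /polar_map rho_k => x [a /translate_value fx].
  by have := value_sphere fx; rewrite [O + _]addrC subrK.
have Sf : sphere c r `<=` zclosure (ratimage (polar_map O rho k)).
  rewrite /polar_map rho_k => x /sphere_value[a [_ fx]].
  apply: sub_zclosure; exists a.
  have := ratvalsD (ratvals_const O a) fx.
  by rewrite [O + _]addrC subrK.
split; split=> //.
  apply: (@zdim_sphere _ _ 0 1 ltr01); apply/seteqP; split=> //.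
  exact: zclosure_min (zclosed_sphere _ ler01) _.
apply: (@zdim_sphere _ _ c r r0); apply/seteqP; split=> //.
exact: zclosure_min (zclosed_sphere _ (ltW r0)) _.
Qed.

Local Notation conchoid_points d := [set Q | exists P, [/\ sphere c r P, P <> O,
    exists t : R, Q = O + t *: (P - O) & enorm (Q - P) = d]].

(** If [Q = O + t *: z] is at distance [d] from [P = O + z], then [t] times the
    distance of [P] from [O] differs by [d] from that distance. *)
Lemma conchoid_points_sub (d : R) : conchoid_points d `<=`
  ratimage (polar_map O (rho + ratC d) k) `|`
  ratimage (polar_map O (rho - ratC d) k).
Proof.
move=> Q [P [PS PO [t QE] QP]].
pose z := P - O; have zN0 : z != 0 by rewrite subr_eq0; apply/eqP.
have [a [rz fz]] := sphere_value PS.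
have en : enorm z != 0 by rewrite enorm_eq0.
have key d' : (t - 1) * enorm z = d' ->
    ratimage (polar_map O (rho + ratC d') k) Q.
  move=> dE; exists a; rewrite -/(ratvals _ _ _).
  have -> : Q = O + (enorm z + d') *: ((enorm z)^-1 *: z).
    by rewrite QE scalerA -dE -/z; congr (_ + _ *: _); field.
  apply: ratvalsD; first exact: ratvals_const.
  apply: ratvalsZ; last exact: k_value.
  exact: ratvalD rz (ratval_const _ _).
have /eqP : ((t - 1) * enorm z) ^+ 2 = d ^+ 2.
  rewrite -QP exprMn !sqr_enorm QE.
  have -> : O + t *: (P - O) - P = (t - 1) *: z.
    by rewrite scalerBl scale1r /z opprB addrCA addrA.
  by rewrite !dot_linear; ring.
rewrite eqf_sqr => /orP[/eqP/key|/eqP/key]; first by left.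
by rewrite rmorphN; right.
Qed.

(** Only parameters at which [rho] and [f] are defined and [rho] does not vanish
    give points [P != O] of the sphere; the other parameters at which
    [(rho + d) k] happens to be defined are limits of these. *)
Lemma conchoid_image_sub (d d' : R) : `|d'| = d ->
  ratimage (polar_map O (rho + ratC d') k) `<=` zclosure (conchoid_points d).
Proof.
move=> d'd; have [a0 [z0 [rho0 f0 z0N]]] := ex_value_neq0.
have [|D Da DP] := ratval_open_neq0 rho0; first by rewrite enorm_eq0.
have [D' Da' DP'] := ratvals_open f0.
apply: (@ratimage_generic _ _ _ (D * D') a0).
  by rewrite mevalM mulf_neq0.
move=> a x; rewrite mevalM mulf_eq0 => /norP[/DP[p rp p0] /DP'[z fz]].
have zz : dot z z = p ^+ 2.
  by apply: ratval_uniq (ratval_dot fz fz) _; rewrite f_norm; exact: ratvalX.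
move=> /translate_value xk.
have xE : x = O + ((p + d') / p) *: z.
  have kz : ratvals k a (p^-1 *: z) := ratvalsZ (ratvalV rp p0) fz.
  have := ratvals_uniq xk (ratvalsZ (ratvalD rp (ratval_const d' a)) kz).
  by rewrite scalerA => <-; rewrite addrC subrK.
exists (O + z); split.
- exact: value_sphere fz.
- apply/eqP; rewrite -subr_eq0 addrAC subrr add0r.
  by rewrite -dot_eq0 zz sqrf_eq0.
- by exists ((p + d') / p); rewrite addrAC subrr add0r.
- rewrite xE opprD addrACA subrr add0r enorm_dot.
  have -> : ((p + d') / p) *: z - z = (d' / p) *: z.
    by rewrite -[X in _ - X]scale1r -scalerBl; congr (_ *: _); field.
  rewrite !dot_linear zz mulrA -expr2 expr_div_n mulfVK ?expf_neq0 //.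
  by rewrite sqrtr_sqr.
Qed.

Lemma rational_distance_conchoid (d : R) : 0 < d ->
  conchoid (sphere c r) O d =
  zclosure (ratimage (polar_map O (rho + ratC d) k) `|`
            ratimage (polar_map O (rho - ratC d) k)).
Proof.
move=> d0; apply/seteqP; split.
  by apply: zclosureS; exact: conchoid_points_sub.
apply: zclosure_min; first exact: zclosed_zclosure.
move=> x [|]; first by apply: conchoid_image_sub; rewrite gtr0_norm.
by rewrite -rmorphN; apply: conchoid_image_sub; rewrite normrN gtr0_norm.
Qed.

End RationalDistance.

(** * A parametrization of the sphere with rational distance from the origin *)

Section Construction.
Variable F : fieldType.
Variables (m g p q tau : F).

(** With [(k, s)] on the unit circle, this runs through the interval between the
    extreme distances [p ^+ 2] and [q ^+ 2] of a sphere from the origin. *)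
Definition distance_fun (k s : F) : F := p ^+ 2 * k ^+ 2 + q ^+ 2 * s ^+ 2.

(** The point of a sphere with centre [(0, 0, m)] whose distance [rho] from the
    origin is [distance_fun k s]. Its third coordinate is determined by [rho],
    and the first two have to satisfy
      [4 m^2 (x1^2 + x2^2) = (q^2 - rho) (rho - p^2) * (q^2 + rho) (p^2 + rho)].
    The first two factors are [(q^2 - p^2) k^2] and [(q^2 - p^2) s^2], with
    product a square. The last two are [(p^2 + q^2) k^2 + 2 q^2 s^2] and
    [2 p^2 k^2 + (p^2 + q^2) s^2], two sums of two squares, so that their product
    is again one, namely [x^2 + y^2] below. Every other solution is obtained by
    rotating through the angle of cosine [k'] and sine [s']. *)
Definition point_fun (k s k' s' : F) : 'rV[F]_3 :=
  let a := (q ^+ 2 - p ^+ 2) * k * s / (2 * m) in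
  let x := tau * (p * k ^+ 2 - q * s ^+ 2) in
  let y := (p + q) ^+ 2 * k * s in
  row3 (a * (k' * x - s' * y)) (a * (s' * x + k' * y))
       ((distance_fun k s ^+ 2 + g) / (2 * m)).

(* For a sphere of radius [r]: [p ^+ 2 = `|m - r|], [q ^+ 2 = m + r] and
   [g = m ^+ 2 - r ^+ 2], without absolute values or reference to [r]. *)
Hypotheses (m0 : m != 0) (two0 : (2 : F) != 0).
Hypotheses (tau2 : tau ^+ 2 = 2 * (p ^+ 2 + q ^+ 2)).
Hypotheses (g2 : g ^+ 2 = p ^+ 4 * q ^+ 4).
Hypotheses (m2 : 4 * m ^+ 2 = p ^+ 4 + q ^+ 4 + 2 * g).

Lemma point_fun_norm k s k' s' :
  k ^+ 2 + s ^+ 2 = 1 -> k' ^+ 2 + s' ^+ 2 = 1 ->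
  dot (point_fun k s k' s') (point_fun k s k' s')
  = distance_fun k s ^+ 2.
Proof.
move=> ks ks'; rewrite dotE !row3E; set rho := distance_fun k s.
set x := tau * _; set a := _ / (2 * m); set y := _ * k * s.
have four0 : (4 : F) != 0 by rewrite (_ : 4 = 2 * 2) ?mulf_neq0 //; ring.
have s2 : s ^+ 2 = 1 - k ^+ 2 by rewrite -ks; ring.
have xy : x ^+ 2 + y ^+ 2 = (q ^+ 2 + rho) * (p ^+ 2 + rho).
  transitivity (2 * (p ^+ 2 + q ^+ 2) * (p * k ^+ 2 - q * s ^+ 2) ^+ 2
                + (p + q) ^+ 4 * k ^+ 2 * s ^+ 2).
    by rewrite -tau2 /x /y; ring.
  by rewrite /rho /distance_fun s2; ring.
have a2 : 4 * m ^+ 2 * a ^+ 2 = (q ^+ 2 - rho) * (rho - p ^+ 2).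
  transitivity ((q ^+ 2 - p ^+ 2) ^+ 2 * k ^+ 2 * s ^+ 2).
    by rewrite /a; field; rewrite ?m0 ?two0.
  by rewrite /rho /distance_fun s2; ring.
apply: (mulfI (mulf_neq0 four0 (expf_neq0 2 m0))).
transitivity (4 * m ^+ 2 * a ^+ 2 * (k' ^+ 2 + s' ^+ 2) * (x ^+ 2 + y ^+ 2)
              + (rho ^+ 2 + g) ^+ 2).
  by field; rewrite ?m0 ?two0.
rewrite ks' a2 xy m2.
have -> : (rho ^+ 2 + g) ^+ 2 = rho ^+ 4 + 2 * g * rho ^+ 2 + g ^+ 2 by ring.
by rewrite g2; ring.
Qed.

Lemma point_fun_sphere k s k' s' r (e := row3 0 0 m) :
  k ^+ 2 + s ^+ 2 = 1 -> k' ^+ 2 + s' ^+ 2 = 1 -> g = m ^+ 2 - r ^+ 2 ->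
  dot (point_fun k s k' s' - e) (point_fun k s k' s' - e) = r ^+ 2.
Proof.
move=> ks ks' gE; have := point_fun_norm ks ks'.
set f := point_fun _ _ _ _ => ff.
have fm : dot f e = (distance_fun k s ^+ 2 + g) / 2.
  by rewrite dotE !row3E; field; rewrite ?m0 ?two0.
have mm : dot e e = m ^+ 2 by rewrite dotE !row3E; ring.
rewrite !(dotDl, dotDr, dotNl, dotNr) (dotC e f) ff fm mm gE.
by field.
Qed.

End Construction.

Section Surjectivity.
Variable R : realType.
Implicit Types (m r p q tau : R) (z : 'rV[R]_3).

Lemma rotation_surj (x y x' y' : R) : x ^+ 2 + y ^+ 2 = x' ^+ 2 + y' ^+ 2 ->
  exists k s, [/\ k ^+ 2 + s ^+ 2 = 1, k * x - s * y = x' & s * x + k * y = y'].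
Proof.
move=> xy; have [n0|n0] := eqVneq (x ^+ 2 + y ^+ 2) 0.
  have zero (a b : R) : a ^+ 2 + b ^+ 2 = 0 -> a = 0 /\ b = 0.
    by move=> /eqP; rewrite paddr_eq0 ?sqr_ge0 // !sqrf_eq0 => /andP[/eqP-> /eqP->].
  have [-> ->] := zero _ _ n0; have [-> ->] := zero _ _ (etrans (esym xy) n0).
  by exists 1, 0; split; ring.
exists ((x * x' + y * y') / (x ^+ 2 + y ^+ 2)).
exists ((x * y' - y * x') / (x ^+ 2 + y ^+ 2)).
split; [|by field..].
transitivity ((x' ^+ 2 + y' ^+ 2) / (x ^+ 2 + y ^+ 2)); first by field.
by rewrite -xy mulfV.
Qed.

(** A given point determines [rho], hence [k ^+ 2] and [s ^+ 2]; for any choice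
    of their signs, its first two coordinates and those of [point_fun] with
    [k' = 1] and [s' = 0] have the same norm, so they differ by a rotation. *)
Lemma point_fun_surj m g p q tau r z (e := row3 0 0 m) :
  0 < m -> 0 < r -> 0 <= p -> p < q -> tau ^+ 2 = 2 * (p ^+ 2 + q ^+ 2) ->
  g ^+ 2 = p ^+ 4 * q ^+ 4 -> 4 * m ^+ 2 = p ^+ 4 + q ^+ 4 + 2 * g ->
  g = m ^+ 2 - r ^+ 2 ->
  dot (z - e) (z - e) = r ^+ 2 ->
  exists k s k' s', [/\ k ^+ 2 + s ^+ 2 = 1, k' ^+ 2 + s' ^+ 2 = 1,
    distance_fun p q k s = enorm z & point_fun m g p q tau k s k' s' = z].
Proof.
move=> m0 r0 p0 pq tau2 g2 m2 gE zS; have mN0 := lt0r_neq0 m0.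
have n0 : 0 <= enorm z by rewrite enorm_dot sqrtr_ge0.
have n2 : enorm z ^+ 2 = z 0 0 ^+ 2 + z 0 1 ^+ 2 + z 0 2%:R ^+ 2.
  by rewrite sqr_enorm dotE; ring.
move: (enorm z) n0 n2 => n n0 n2.
have z2 : z 0 2%:R = (n ^+ 2 + g) / (2 * m).
  move: zS; rewrite dotE !mxE /= !subr0 => zS; apply: (mulIf mN0).
  by rewrite n2 gE -zS; field.
have perp : 4 * m ^+ 2 * (z 0 0 ^+ 2 + z 0 1 ^+ 2)
    = (q ^+ 4 - n ^+ 2) * (n ^+ 2 - p ^+ 4).
  have -> : z 0 0 ^+ 2 + z 0 1 ^+ 2 = n ^+ 2 - z 0 2%:R ^+ 2 by rewrite n2; ring.
  transitivity (4 * m ^+ 2 * n ^+ 2 - (n ^+ 2 + g) ^+ 2); first by rewrite z2; field.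
  transitivity (4 * m ^+ 2 * n ^+ 2 - n ^+ 4 - 2 * g * n ^+ 2 - g ^+ 2); first by ring.
  by rewrite m2 g2; ring.
have perp0 : 0 <= (q ^+ 4 - n ^+ 2) * (n ^+ 2 - p ^+ 4).
  rewrite -perp; apply: mulr_ge0; last exact: addr_ge0 (sqr_ge0 _) (sqr_ge0 _).
  exact: mulr_ge0 (ler0n _ 4) (sqr_ge0 m).
have pq2 : 0 < q ^+ 2 - p ^+ 2 by nra.
have p4q4 : p ^+ 4 < q ^+ 4 by rewrite ltr_pXn2r ?nnegrE // ltW // (le_lt_trans p0).
have lt4 (a b : R) : 0 <= a -> a < b -> a ^+ 2 < b ^+ 2.
  by move=> a0 ab; rewrite ltr_pXn2r ?nnegrE // ltW // (le_lt_trans a0).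
have np : p ^+ 2 <= n.
  rewrite leNgt; apply/negP => /(lt4 _ _ n0); rewrite -exprM => np.
  have qn : 0 < q ^+ 4 - n ^+ 2 by rewrite subr_gt0 (lt_trans np).
  by move: perp0; rewrite pmulr_rge0 // subr_ge0 leNgt np.
have nq : n <= q ^+ 2.
  rewrite leNgt; apply/negP => /(lt4 _ _ (sqr_ge0 q)); rewrite -exprM => nq.
  have pn : 0 < n ^+ 2 - p ^+ 4 by rewrite subr_gt0 (lt_trans p4q4).
  by move: perp0; rewrite pmulr_lge0 // subr_ge0 leNgt nq.
pose k := Num.sqrt ((q ^+ 2 - n) / (q ^+ 2 - p ^+ 2)).
pose s := Num.sqrt ((n - p ^+ 2) / (q ^+ 2 - p ^+ 2)).
have k2 : k ^+ 2 = (q ^+ 2 - n) / (q ^+ 2 - p ^+ 2).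
  by rewrite sqr_sqrtr // divr_ge0 ?(ltW pq2) // subr_ge0.
have s2 : s ^+ 2 = (n - p ^+ 2) / (q ^+ 2 - p ^+ 2).
  by rewrite sqr_sqrtr // divr_ge0 ?(ltW pq2) // subr_ge0.
have pqN0 := lt0r_neq0 pq2.
have ks : k ^+ 2 + s ^+ 2 = 1 by rewrite k2 s2; field.
have rhoE : distance_fun p q k s = n by rewrite /distance_fun k2 s2; field.
have norm_eq : forall k' s', k' ^+ 2 + s' ^+ 2 = 1 ->
    point_fun m g p q tau k s k' s' 0 0 ^+ 2
    + point_fun m g p q tau k s k' s' 0 1 ^+ 2 = z 0 0 ^+ 2 + z 0 1 ^+ 2.
  move=> k' s' ks'; apply: (@addIr _ (z 0 2%:R ^+ 2)); rewrite -n2 -rhoE.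
  rewrite -(point_fun_norm mN0 _ tau2 g2 m2 ks ks') ?pnatr_eq0 // dotE.
  by rewrite -!expr2; congr (_ + _ ^+ 2); rewrite z2 -rhoE row3E.
have := norm_eq 1 0; rewrite !row3E => /(_ _)/rotation_surj[]; first by ring.
move=> k' [s' [ks' xE yE]]; exists k, s, k', s'; split=> //.
rewrite [RHS]row3_eta z2 -rhoE; congr row3.
  by rewrite -xE; ring.
by rewrite -yE; ring.
Qed.

End Surjectivity.

(** * Polar representations of the sphere *)

Section SpherePolar.
Variable R : realType.
Implicit Types (c O z : 'rV[R]_3) (a : 'rV[R]_2) (r m : R).

Definition coord (i : 'I_2) : ratfun R := tofrac 'X_i.

Lemma ratval_coord i a : ratval (coord i) a (a 0 i).
Proof. by rewrite -[X in ratval _ _ X](mevalXU (a 0)); exact: ratval_tofrac. Qed.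

Lemma ratval_nat n a : ratval n%:R a n%:R.
Proof. by rewrite -(rmorph_nat (@ratC R)); exact: ratval_const. Qed.

Lemma ratval_trig i a :
  [/\ ratval (1 + coord i ^+ 2) a (1 + a 0 i ^+ 2),
      ratval (cosr (coord i)) a (cosr (a 0 i)) &
      ratval (sinr (coord i)) a (sinr (a 0 i))].
Proof.
have x1 := ratval_coord i a; have n := ratval_nat^~ a.
have x2 := ratvalX 2 x1; have d := ratvalD (n 1%N) x2.
have d2 := ratvalX 2 d; have dN0 := expf_neq0 2 (trig_den_neq0 (a 0 i)).
split=> //.
- apply: ratval_div d2 dN0; apply: ratvalB; apply: ratvalX.
    exact: ratvalB (n 1%N) x2.
  exact: ratvalM (n 2) x1.
- apply: ratval_div d2 dN0; apply: ratvalM.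
    exact: ratvalM (n 2) (ratvalB (n 1%N) x2).
  exact: ratvalM (n 2) x1.
Qed.

Local Notation k i := (cosr (coord i)).
Local Notation s i := (sinr (coord i)).

Lemma coord_trig i : k i ^+ 2 + s i ^+ 2 = 1.
Proof.
have [d _ _] := ratval_trig i 0.
exact: cosr2Dsinr2 (ratval_neq0 d (trig_den_neq0 _)).
Qed.

Lemma ex_trig_values (x y x' y' : R) :
  x ^+ 2 + y ^+ 2 = 1 -> x' ^+ 2 + y' ^+ 2 = 1 ->
  exists a, [/\ ratval (k 0) a x, ratval (s 0) a y,
                ratval (k 1) a x' & ratval (s 1) a y'].
Proof.
move=> /cosr_sinr_surj[t [<- <-]] /cosr_sinr_surj[t' [<- <-]].
pose a : 'rV[R]_2 := \row_i [:: t; t']`_i; exists a.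
have [_ k0 s0] := ratval_trig 0 a; have [_ k1 s1] := ratval_trig 1 a.
by move: k0 s0 k1 s1; rewrite !mxE.
Qed.

Lemma ratvals_row3 (x y z : ratfun R) a (x' y' z' : R) :
  ratval x a x' -> ratval y a y' -> ratval z a z' ->
  ratvals (row3 x y z) a (row3 x' y' z').
Proof. by move=> hx hy hz [[|[|[|//]]] ilt]; rewrite !mxE. Qed.

Lemma map_row3 (x y z : R) :
  map_mx (@ratC R) (row3 x y z) = row3 (ratC x) (ratC y) (ratC z).
Proof. by apply/rowP=> -[[|[|[|//]]] ilt]; rewrite !mxE. Qed.

Definition polar_conchoids c O r (rho : ratfun R) (h : 'rV[ratfun R]_3) :=
  polar_representation O (sphere c r) rho h /\
  forall d : R, 0 < d ->
    conchoid (sphere c r) O d =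
    zclosure (ratimage (polar_map O (rho + ratC d) h) `|`
              ratimage (polar_map O (rho - ratC d) h)).

(** A rotation moves the centre to the third axis, with the focus as origin. *)
Lemma polar_conchoids_axis c O r m (rho : ratfun R) (f : 'rV[ratfun R]_3)
    (e := row3 0 0 m) (eK := row3 0 0 (ratC m)) : 0 < r -> enorm (c - O) = m ->
  dot f f = rho ^+ 2 -> dot (f - eK) (f - eK) = ratC r ^+ 2 ->
  (forall z, dot (z - e) (z - e) = r ^+ 2 ->
     exists a, ratval rho a (enorm z) /\ ratvals f a z) ->
  exists rho h, polar_conchoids c O r rho h.
Proof.
move=> r0 cO ff fr surj; have [E [E1 vE]] := householder (c - O).
rewrite cO in vE; pose EK := map_mx (@ratC R) E.
have EK1 : EK *m EK^T = 1%:M by rewrite map_trmx -map_mxM E1 map_mx1.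
have gg : dot (f *m EK) (f *m EK) = rho ^+ 2 by rewrite dot_orthogonal.
have gr : dot (f *m EK - map_mx (@ratC R) (c - O))
              (f *m EK - map_mx (@ratC R) (c - O)) = ratC r ^+ 2.
  by rewrite vE map_mxM map_row3 !rmorph0 -mulmxBl dot_orthogonal.
have gsurj z : dot (z - (c - O)) (z - (c - O)) = r ^+ 2 ->
    exists a, ratval rho a (enorm z) /\ ratvals (f *m EK) a z.
  have zE : z = (z *m E^T) *m E by rewrite -mulmxA (mulmx1C E1) mulmx1.
  rewrite zE vE -mulmxBl dot_orthogonal // => /surj[a [ra fa]].
  exists a; split; last exact: ratvals_mul.
  by rewrite enorm_dot dot_orthogonal // -enorm_dot.
exists rho, (rho^-1 *: (f *m EK)).
by split; [apply: rational_distance_polar|apply: rational_distance_conchoid].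
Qed.

Lemma polar_conchoids_centred c O r :
  0 < r -> enorm (c - O) = 0 -> exists rho h, polar_conchoids c O r rho h.
Proof.
move=> r0 cO; have rN0 := lt0r_neq0 r0.
pose f := ratC r *: row3 (s 0 * k 1) (s 0 * s 1) (k 0).
have ff : dot f f = ratC r ^+ 2.
  rewrite !(dotZl, dotZr) dotE !row3E.
  transitivity (ratC r ^+ 2 * (s 0 ^+ 2 * (k 1 ^+ 2 + s 1 ^+ 2) + k 0 ^+ 2)).
    by ring.
  by rewrite coord_trig mulr1 addrC coord_trig mulr1.
have row30 (F : comNzRingType) : row3 0 0 0 = 0 :> 'rV[F]_3.
  by apply/rowP => -[[|[|[|//]]] ilt]; rewrite !mxE.
apply: (polar_conchoids_axis (f := f) r0 cO ff).
  by rewrite rmorph0 row30 subr0.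
move=> z; rewrite row30 subr0 => zz.
have zE : enorm z = r by rewrite enorm_dot zz sqrtr_sqr gtr0_norm.
(* [n] is the sine of the polar angle of [z] *)
pose n := Num.sqrt ((z 0 0 / r) ^+ 2 + (z 0 1 / r) ^+ 2).
have n2 : n ^+ 2 = (z 0 0 / r) ^+ 2 + (z 0 1 / r) ^+ 2.
  by rewrite sqr_sqrtr // addr_ge0 ?sqr_ge0.
have n2' : n ^+ 2 + 0 ^+ 2 = (z 0 0 / r) ^+ 2 + (z 0 1 / r) ^+ 2.
  by rewrite expr0n addr0.
have [k' [s' [ks' xE yE]]] := rotation_surj n2'.
have zn : (z 0 2%:R / r) ^+ 2 + n ^+ 2 = 1.
  rewrite n2; apply: (mulfI (expf_neq0 2 rN0)); rewrite mulr1 -[RHS]zz dotE.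
  by field.
have [a [k0 s0 k1 s1]] := ex_trig_values zn ks'.
exists a; rewrite zE; split; first exact: ratval_const.
have -> : z = r *: row3 (n * k') (n * s') (z 0 2%:R / r).
  rewrite {1}[z]row3_eta; apply/rowP => -[[|[|[|//]]] ilt]; rewrite !mxE /=.
  - by rewrite (_ : n * k' = z 0 0 / r); [field|rewrite -xE; ring].
  - by rewrite (_ : n * s' = z 0 1 / r); [field|rewrite -yE; ring].
  - by field.
by apply: ratvalsZ (ratval_const _ _) _; apply: ratvals_row3 => //; apply: ratvalM.
Qed.

Lemma ratval_distance_fun p q a (x y : R) :
  ratval (k 0) a x -> ratval (s 0) a y ->
  ratval (distance_fun (ratC p) (ratC q) (k 0) (s 0)) a (distance_fun p q x y).
Proof.
have cst u := ratval_const (R := R) u a.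
by move=> k0 s0; apply: ratvalD; apply: ratvalM; apply: ratvalX.
Qed.

Lemma ratvals_point_fun m g p q tau a (x y x' y' : R) : m != 0 ->
  ratval (k 0) a x -> ratval (s 0) a y -> ratval (k 1) a x' -> ratval (s 1) a y' ->
  ratvals (point_fun (ratC m) (ratC g) (ratC p) (ratC q) (ratC tau)
             (k 0) (s 0) (k 1) (s 1)) a (point_fun m g p q tau x y x' y').
Proof.
move=> mN0 k0 s0 k1 s1; have cst u := ratval_const (R := R) u a.
have mm : 2 * m != 0 by rewrite mulf_neq0 ?pnatr_eq0.
have md := ratvalM (ratval_nat 2 a) (cst m).
have A : ratval ((ratC q ^+ 2 - ratC p ^+ 2) * k 0 * s 0 / (2 * ratC m)) a
                ((q ^+ 2 - p ^+ 2) * x * y / (2 * m)).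
  apply: ratval_div md mm; apply: ratvalM => //; apply: ratvalM => //.
  by apply: ratvalB; apply: ratvalX.
have X : ratval (ratC tau * (ratC p * k 0 ^+ 2 - ratC q * s 0 ^+ 2)) a
                (tau * (p * x ^+ 2 - q * y ^+ 2)).
  by apply: ratvalM => //; apply: ratvalB; apply: ratvalM => //; apply: ratvalX.
have Y : ratval ((ratC p + ratC q) ^+ 2 * k 0 * s 0) a ((p + q) ^+ 2 * x * y).
  by apply: ratvalM => //; apply: ratvalM => //; apply: ratvalX; apply: ratvalD.
apply: ratvals_row3.
- by apply: ratvalM A _; apply: ratvalB; apply: ratvalM.
- by apply: ratvalM A _; apply: ratvalD; apply: ratvalM.
- apply: ratval_div md mm; apply: ratvalD => //; apply: ratvalX.
  exact: ratval_distance_fun.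
Qed.

Lemma polar_conchoids_off_centre c O r m : 0 < r -> enorm (c - O) = m -> 0 < m ->
  exists rho h, polar_conchoids c O r rho h.
Proof.
move=> r0 cO m0; have mN0 := lt0r_neq0 m0.
pose p := Num.sqrt `|m - r|; pose q := Num.sqrt (m + r).
have p2 : p ^+ 2 = `|m - r| by rewrite sqr_sqrtr.
have q2 : q ^+ 2 = m + r by rewrite sqr_sqrtr // addr_ge0 ?ltW.
have p4 : p ^+ 4 = (m - r) ^+ 2.
  by rewrite -[4%N]/(2 * 2)%N exprM p2 real_normK ?num_real.
have q4 : q ^+ 4 = (m + r) ^+ 2 by rewrite -[4%N]/(2 * 2)%N exprM q2.
have p0 : 0 <= p by exact: sqrtr_ge0.
have pq : p < q.
  by rewrite ltr_sqrt ?addr_gt0 // ltr_norml; apply/andP; split; lra.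
pose tau := Num.sqrt (2 * (p ^+ 2 + q ^+ 2)).
have tau2 : tau ^+ 2 = 2 * (p ^+ 2 + q ^+ 2).
  by rewrite sqr_sqrtr // mulr_ge0 ?addr_ge0 ?sqr_ge0.
pose g := m ^+ 2 - r ^+ 2.
have g2 : g ^+ 2 = p ^+ 4 * q ^+ 4 by rewrite p4 q4 /g; ring.
have m2 : 4 * m ^+ 2 = p ^+ 4 + q ^+ 4 + 2 * g by rewrite p4 q4 /g; ring.
pose C := @ratC R.
have CmN0 : C m != 0 by rewrite fmorph_eq0.
have C2 : (2 : ratfun R) != 0 by rewrite -(rmorph_nat C) fmorph_eq0 pnatr_eq0.
have Ctau : C tau ^+ 2 = 2 * (C p ^+ 2 + C q ^+ 2).
  by rewrite -!rmorphXn -rmorphD tau2 rmorphM rmorph_nat.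
have Cg2 : C g ^+ 2 = C p ^+ 4 * C q ^+ 4.
  by rewrite -!rmorphXn -rmorphM g2.
have Cm2 : 4 * C m ^+ 2 = C p ^+ 4 + C q ^+ 4 + 2 * C g.
  by rewrite -!rmorphXn -!(rmorph_nat C) -!rmorphM -!rmorphD m2.
have Cg : C g = C m ^+ 2 - C r ^+ 2 by rewrite /C /g rmorphB !rmorphXn.
have ks0 := coord_trig 0; have ks1 := coord_trig 1.
apply: (polar_conchoids_axis (rho := distance_fun (C p) (C q) (k 0) (s 0))
  (f := point_fun (C m) (C g) (C p) (C q) (C tau) (k 0) (s 0) (k 1) (s 1)) r0 cO).
- exact: point_fun_norm.
- exact: point_fun_sphere.
move=> z /(point_fun_surj m0 r0 p0 pq tau2 g2 m2 erefl).
move=> [x [y [x' [y' [xy xy' <- <-]]]]].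
have [a [k0 s0 k1 s1]] := ex_trig_values xy xy'.
by exists a; split; [apply: ratval_distance_fun|apply: ratvals_point_fun].
Qed.

End SpherePolar.

Theorem theorem6 (R : realType) (c : 'rV[R]_3) (r : R) (hr : 0 < r)
    (O : 'rV[R]_3) :
  exists (rho : ratfun R) (k : 'rV[ratfun R]_3),
    polar_representation O (sphere c r) rho k /\
    forall d : R, 0 < d ->
      conchoid (sphere c r) O d =
      zclosure (ratimage (polar_map O (rho + ratC d) k) `|`
                ratimage (polar_map O (rho - ratC d) k)).
Proof.
have [cO|cO] := eqVneq (enorm (c - O)) 0; first exact: polar_conchoids_centred.
apply: (polar_conchoids_off_centre hr erefl).
by rewrite lt0r cO enorm_ge0.
Qed.
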